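(* Let $\alpha\in(0,1/2]$ and consider the model D-EX-t$(\zeta_n)$ described in the context with $\lim_{n\to\infty}\zeta_n=1$; write $\operatorname{FDR}_\infty(1)=\operatorname{FDR}_\infty(1;\nu)$ for its dependence on the degrees of freedom $\nu$. Then \[ \lim_{\nu\to\infty}\operatorname{FDR}_\infty(1;\nu)=\Phi\big(-\sqrt{-2\ln(\alpha)}\big). \]
   Context: Model D-EX-t$(\zeta_n)$ with $\nu$ degrees of freedom: $X_1,\dots,X_n$ independent with $X_i\sim N(\vartheta_i,1)$, $S>0$ with $\nu S^2\sim\chi^2_\nu$ independent of the $X_i$; $\Phi$ is the standard normal c.d.f. and $F_{t_\nu}$ the central $t_\nu$ c.d.f. For $H_i:\vartheta_i=0$ vs $K_i:\vartheta_i>0$, $T_i=X_i/S$ and $p_i=1-F_{t_\nu}(T_i)$; $\vartheta_i=\infty$ is allowed and gives $p_i=0$ a.s. For each $n$, exactly $n_0$ hypotheses are true ($\vartheta_i=0$), $\zeta_n=n_0/n$, and the rest have $\vartheta_i=\infty$. The linear step-up procedure at level $\alpha$ rejects all $H_i$ with $p_i\le m\alpha/n$, $m=\max\{i:p_{i:n}\le i\alpha/n\}$ (ordered $p$-values $p_{1:n}\le\dots\le p_{n:n}$). $V_n$ = number of rejected true hypotheses, $R_n$ = number of rejections, and $\operatorname{FDR}_\infty(1)=\lim_{n\to\infty}\mathbb E[V_n/(R_n\vee1)]$. *)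

(* Defs.v *)
From HB Require Import structures.
From mathcomp Require Import all_boot all_order all_algebra.
From mathcomp Require Import all_classical all_reals all_analysis.
Set Implicit Arguments. Unset Strict Implicit. Unset Printing Implicit Defensive.
Import Order.TTheory GRing.Theory Num.Theory.
Import numFieldNormedType.Exports.
Local Open Scope classical_set_scope.
Local Open Scope ring_scope.

Section Defs.
Variable R : realType.

Definition leb := (@lebesgue_measure R).

Definition phi (x : R) : R := normal_pdf 0 1 x.
Definition Phi (x : R) : R := Rintegral leb `]-oo, x] phi.

Definition chi2_kernel (nu : nat) (u : R) : R :=
  powR u (nu%:R / 2 - 1) * expR (- u / 2).
Definition chi2_const (nu : nat) : R := Rintegral leb `]0, +oo[ (chi2_kernel nu).

(* E[g(S)] where S > 0 and nu * S^2 ~ chi^2_nu, i.e. S = sqrt(U/nu), U ~ chi^2_nu *)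
Definition ES (nu : nat) (g : R -> R) : R :=
  Rintegral leb `]0, +oo[
    (fun u => chi2_kernel nu u / chi2_const nu * g (Num.sqrt (u / nu%:R))).

(* central t_nu c.d.f. : the c.d.f. of Z/S, Z ~ N(0,1) independent of S,
   P(Z/S <= x) = E[Phi(x S)] *)
Definition Ft (nu : nat) (x : R) : R := ES nu (fun s => Phi (x * s)).

Fixpoint gaussE (k : nat) (f : seq R -> R) : R :=
  match k with
  | 0 => f [::]
  | k'.+1 => Rintegral leb setT (fun x => phi x * gaussE k' (fun l => f (x :: l)))
  end.

Definition LSU_m (alpha : R) (p : seq R) : nat :=
  let n := size p in
  let ps := sort <=%R p in
  \max_(k < n.+1 | (0 < k)%N && (nth 0 ps k.-1 <= k%:R * alpha / n%:R)) k.

Definition LSU_rej (alpha : R) (p : seq R) (x : R) : bool :=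
  (0 < LSU_m alpha p)%N && (x <= (LSU_m alpha p)%:R * alpha / (size p)%:R).

(* V/(R v 1) where the first n0 entries of p are the true nulls *)
Definition FDP (alpha : R) (n0 : nat) (p : seq R) : R :=
  (count (LSU_rej alpha p) (take n0 p))%:R /
    (maxn (count (LSU_rej alpha p) p) 1)%:R.

Definition pval (nu : nat) (s x : R) : R := 1 - Ft nu (x / s).

(* FDR of the LSU in D-EX-t: n hypotheses, n0 true (theta = 0),
   n - n0 with theta = oo (p-value 0) *)
Definition FDR_DEXt (alpha : R) (nu n n0 : nat) : R :=
  ES nu (fun s => gaussE n0 (fun xs =>
    FDP alpha n0 ([seq pval nu s x | x <- xs] ++ nseq (n - n0) 0))).

End Defs.

(* Main.v *)
Require Import Defs.
From HB Require Import structures.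
From mathcomp Require Import all_boot all_order all_algebra.
From mathcomp Require Import all_classical all_reals all_analysis.
From mathcomp Require Import measurable_realfun.
From mathcomp Require Import ring lra.
Set Implicit Arguments. Unset Strict Implicit. Unset Printing Implicit Defensive.
Import Order.TTheory GRing.Theory Num.Theory.
Import numFieldNormedType.Exports.
Local Open Scope classical_set_scope.
Local Open Scope ring_scope.

(**
Given [S = s] the p-values are i.i.d. with [P(p_i <= t_tail y) = Phi (- s y)], where [t_tail y = E (Phi (- y S))] is the upper tail of the t distribution. If [t_tail y < alpha * Phi (- s y)] for some [y > 0], the law of large numbers makes a positive fraction of the hypotheses rejected, nearly all of them true ones, and the false discovery proportion tends to [1]. If [t_tail y > alpha * Phi (- s y)] for all [y], then [V / R] is at most the mean of [alpha / p_i] over the small p-values, which is integrable, and the proportion tends to [0]. The first property is decreasing in [s], so the limit is [P (S <= s0)] for a critical scale [s0].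

Write [S = exp (c x / 2)] with [c = sqrt (2 / nu)]: [x] has density proportional to [logchi nu x = exp (- (nu / 2) (exp (c x) - 1 - c x))], which tends to [exp (- x ^ 2 / 2)]. Mills-type bounds compare [Phi (- y S) / Phi (- y s)] with [exp (- y ^ 2 (S ^ 2 - s ^ 2) / 2)] up to a factor close to [1], and the infimum over [y] of the expectation of the latter at [s = exp (c w / 2)], [w < 0], is exactly [logchi nu w]. Hence [s0] corresponds to the negative root of [exp (- w ^ 2 / 2) = alpha].
*)

(** * Lebesgue integrals *)

(** Neither the false discovery proportion nor its conditional mean given [S] is ever shown
    measurable: each is enclosed between functions whose integrals are known, and only the
    monotonicity of the integral is used. Over the normal variables the enclosing functions are
    constants, sums and squares of centred counts, so the law of large numbers becomes Chebyshev's
    inequality written pointwise. Over [S] they are step functions.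

    Neither alternative of the dichotomy decides [s = s0]. Each is proved with a margin on its own
    side, and the margins close because the law of [x] has a bounded density.

    The bound [alpha <= 1 / 2] enters through [t_tail 0 = 1 / 2]: rejection thresholds never exceed
    [alpha], hence they are values of [t_tail] at some [y >= 0], the range of the tail bounds.

    The infimum over [y] is explicit: the expectation is [exp (y ^ 2 s ^ 2 / 2) (1 + y ^ 2 / nu) ^
    (- nu / 2)], minimal at [y ^ 2 = nu (s ^ -2 - 1)], which is positive exactly for [s < 1], that
    is [w < 0]. *)

Section Lebesgue.
Context d {T : measurableType d} {R : realType} (mu : {measure set T -> \bar R}).
Implicit Types (D : set T) (f g h : T -> R).

(* The integrands need not be measurable: the integral of a nonnegative function is a supremum over simple functions, hence monotone unconditionally. *)
Lemma le_Rintegral_dominated D f g h : measurable D ->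
  mu.-integrable D (EFin \o h) ->
  (forall x, D x -> `|f x| <= h x) -> (forall x, D x -> `|g x| <= h x) ->
  (forall x, D x -> f x <= g x) ->
  Rintegral mu D f <= Rintegral mu D g.
Proof.
move=> mD ih fh gh fg.
have le_int (a b : T -> \bar R) : (forall x, 0 <= a x)%E -> (forall x, a x <= b x)%E ->
    (\int[mu]_x a x <= \int[mu]_x b x)%E.
  move=> a0 ab; rewrite !ge0_integralTE//; last by move=> x; exact: le_trans (ab x).
  apply: ereal_sup_le => _ [k /= ka <-]; exists k => //.
  by move=> x; exact: le_trans (ka x) (ab x).
pose pt (a : T -> R) x : \bar R := ((EFin \o a) \_ D) x.
have iE (a : T -> R) : (\int[mu]_(x in D) (a x)%:E = \int[mu]_x ((pt a)^\+ x) - \int[mu]_x ((pt a)^\- x))%E.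
  by rewrite integral_mkcond integralE.
have hfin : (\int[mu]_x (pt h x) < +oo)%E.
  rewrite -integral_mkcond; have := integrable_fin_num mD ih.
  by rewrite ltey => /fin_numPlt/andP[_]; rewrite ltey.
have bnd (a : T -> R) : (forall x, D x -> `|a x| <= h x) ->
    (\int[mu]_x ((pt a)^\+ x) \is a fin_num)%E /\ (\int[mu]_x ((pt a)^\- x) \is a fin_num)%E.
  { move=> ah; split; rewrite ge0_fin_numE ?integral_ge0//; apply: le_lt_trans hfin;
    apply: le_int => // x; rewrite ?funeposE ?funenegE /pt /patch; case: ifPn => [/set_mem Dx|_];
    rewrite ?oppe0 ?maxxx//=.
  all: have := ah _ Dx; rewrite ler_norml => /andP[h1 h2].
  all: rewrite ge_max -?EFinN !lee_fin; apply/andP; split; lra. }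
have [fp fn] := bnd _ fh; have [gp gn] := bnd _ gh.
rewrite /Rintegral !iE fine_le//.
- by rewrite fin_numB fp fn.
- by rewrite fin_numB gp gn.
apply: leeB; apply: le_int => // x; rewrite ?funeposE ?funenegE /pt /patch/=;
  case: ifPn => // /set_mem Dx; rewrite ge_max; apply/andP; split;
  rewrite le_max ?lexx ?orbT// -?EFinN lee_fin ?lerN2 fg//.
Qed.

End Lebesgue.

(** * Changes of variables on half-lines and on the whole line *)

Section Substitution.
Context {R : realType}.
Notation mu := (@lebesgue_measure R).

Lemma affine_substitutiony (G : R -> R) (a b r : R) : 0 < r ->
  continuous G -> (forall x, 0 <= G x) ->
  (\int[mu]_(x in `[b, +oo[) (G x)%:E =
   \int[mu]_(x in `[a, +oo[) (G (b + r * (x - a)) * r)%:E)%E.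
Proof.
move=> r0 cG G0.
pose F (x : R) := b + r * (x - a).
have dF (x : R) : is_derive x 1 F r.
  have -> : F = cst (b - r * a) + r \*: (@id R).
    by apply/funext => y; rewrite /F !fctE /=; rewrite -[(r *: y)]/(r * y); ring.
  by apply: is_derive_eq; rewrite add0r /GRing.scale/= mulr1.
have F' : F^`()%classic = cst r.
  by apply/funext => x; rewrite derive1E; have [_ ->] := dF x.
have Fa : F a = b by rewrite /F subrr mulr0 addr0.
have cF : continuous F.
  by move=> x; apply/differentiable_continuous/derivable1_diffP; have [] := dF x.
rewrite -{1}Fa (@increasing_ge0_integration_by_substitutiony _ F G a).
- by apply: eq_integral => x _; rewrite !fctE F'.
- by move=> x y _ _ xy; rewrite /F ltrD2l ltr_pM2l// ltrD2r.
- by rewrite F' => x _; exact: cst_continuous.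
- by rewrite F'; exact: is_cvg_cst.
- by rewrite F'; exact: is_cvg_cst.
- by split; [move=> x _; have [] := dF x|exact/cvg_at_right_filter/cF].
- rewrite /F; apply/cvgryPge => M; near=> x.
  rewrite -lerBlDl mulrC -ler_pdivrMr// lerBrDr; near: x.
  by apply: nbhs_pinfty_ge; rewrite num_real.
- exact: continuous_subspaceT.
- by move=> x _; exact: G0.
Unshelve. all: end_near. Qed.

Let normr_le_nat (x : R) : exists n : nat, `|x| <= n%:R.
Proof. by exists (Num.bound `|x|); rewrite ltW// archi_boundP. Qed.

Section exp_substitution.
Variables (A c : R) (A0 : 0 < A) (c0 : 0 < c).
Variable G : R -> R.
Hypotheses (cG : {in `]0, +oo[, continuous G}) (G0 : forall x, 0 < x -> 0 <= G x).

Let F (x : R) := A * expR (c * x).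

Let dF (x : R) : is_derive x 1 F (A * (c * expR (c * x))).
Proof.
have -> : F = (fun x => A *: (expR \o (fun y => c *: y)) x) by [].
apply: is_derive_eq.
by rewrite /GRing.scale /= /comp; ring.
Qed.

Let F'E : F^`()%classic = fun x => A * (c * expR (c * x)).
Proof. by apply/funext => x; rewrite derive1E; have [_ ->] := dF x. Qed.

Let cexp : continuous (fun x : R => expR (c * x)).
Proof.
move=> x; apply: (@continuous_comp _ _ _ (fun x => c * x) expR); last exact: continuous_expR.
by apply: cvgM; [exact: cvg_cst|exact: cvg_id].
Qed.

Let cF : continuous F.
Proof. by move=> x; apply: cvgM; [exact: cvg_cst|exact: cexp]. Qed.

Let cF' : continuous F^`()%classic.
Proof.
rewrite F'E => x; apply: cvgM; first exact: cvg_cst.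
by apply: cvgM; [exact: cvg_cst|exact: cexp].
Qed.

Let F0 x : 0 < F x. Proof. by rewrite mulr_gt0 ?expR_gt0. Qed.

Let incF : {homo F : x y / x < y}.
Proof. by move=> x y xy; rewrite /F ltr_pM2l// ltr_expR ltr_pM2l. Qed.

Let FK x : 0 < x -> x = F (ln (x / A) / c).
Proof.
move=> x0; rewrite /F mulrC [c * _]mulrC divfK ?gt_eqF// lnK ?posrE ?divr_gt0//.
by rewrite divfK ?gt_eqF.
Qed.

Let H x := G (A * expR (c * x)) * (A * (c * expR (c * x))).

Let cGF : continuous (fun x => G (F x)).
Proof.
move=> x; apply: (@continuous_comp _ _ _ F G); first exact: cF.
by apply: cG; rewrite in_itv/= andbT; exact: F0.
Qed.

Let H0 x : 0 <= H x.
Proof. by rewrite mulr_ge0 ?G0 ?F0// !mulr_ge0 ?expR_ge0// ltW. Qed.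

Let mH : measurable_fun setT H.
Proof.
apply: continuous_measurable_fun => x; apply: cvgM; first exact: cGF.
by have := @cF' x; rewrite F'E.
Qed.

Let mG : measurable_fun `](0 : R), +oo[ G.
Proof.
apply: open_continuous_measurable_fun; first exact: interval_open.
by move=> x; rewrite inE => /cG.
Qed.

Let finite_itv a b : a <= b ->
  (\int[mu]_(x in `[F a, F b]) (G x)%:E = \int[mu]_(x in `[a, b]) (H x)%:E)%E.
Proof.
move=> ab; rewrite integration_by_substitution_increasing//.
- by apply: eq_integral => x _; rewrite !fctE F'E.
- by move=> x y _ _; exact: incF.
- by apply: (cvgP (F^`()%classic a)); exact/cvg_at_right_filter/cF'.
- by apply: (cvgP (F^`()%classic b)); exact/cvg_at_left_filter/cF'.
- split; first by move=> x _; have [] := dF x.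
  + exact/cvg_at_right_filter/cF.
  + exact/cvg_at_left_filter/cF.
- apply: continuous_in_subspaceT => x; rewrite inE/= in_itv/= => /andP[ax _].
  by apply: cG; rewrite in_itv/= andbT (lt_le_trans (F0 a)).
Qed.

(** Substitution holds on compact intervals, and monotone convergence along growing ones extends it
    to their union. Leaving the endpoints free serves both the half-line and the whole line. *)
Let limit_itv (a b : nat -> R) (D E : set R) :
  (forall n, a n <= b n) -> nonincreasing_seq a -> nondecreasing_seq b ->
  \bigcup_n `[F (a n), F (b n)]%classic = D -> \bigcup_n `[a n, b n]%classic = E ->
  (\int[mu]_(x in D) (G x)%:E = \int[mu]_(x in E) (H x)%:E)%E.
Proof.
move=> ab na nb <- <-.
have ndE : nondecreasing_seq (fun n => `[a n, b n]%classic).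
  move=> m n mn; rewrite subsetEset => x /=; rewrite !in_itv/= => /andP[ax xb].
  by rewrite (le_trans (na _ _ mn))//= (le_trans xb)// nb.
have ndD : nondecreasing_seq (fun n => `[F (a n), F (b n)]%classic).
  move=> m n mn; rewrite subsetEset => x /=; rewrite !in_itv/= => /andP[ax xb].
  have hF : {mono F : x y / x <= y} by apply: le_mono; exact: incF.
  by rewrite (le_trans _ ax) ?hF ?na//= (le_trans xb)// hF nb.
have c1 : (\int[mu]_(x in `[F (a n), F (b n)]) (G x)%:E @[n --> \oo] -->
    \int[mu]_(x in \bigcup_n `[F (a n), F (b n)]%classic) (G x)%:E)%E.
  apply: ge0_nondecreasing_set_cvg_integral => //.
  - move=> n; apply/measurable_EFinP; apply: measurable_funS mG => // x/=.
    by rewrite !in_itv/= andbT => /andP[+ _]; exact: lt_le_trans.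
  - move=> n x /=; rewrite in_itv/= => /andP[ax _]; rewrite lee_fin G0//.
    exact: lt_le_trans ax.
have c2 : (\int[mu]_(x in `[a n, b n]) (H x)%:E @[n --> \oo] -->
    \int[mu]_(x in \bigcup_n `[a n, b n]%classic) (H x)%:E)%E.
  apply: ge0_nondecreasing_set_cvg_integral => //.
  - by move=> n; apply/measurable_EFinP; exact: measurable_funTS.
  - by move=> n x _; rewrite lee_fin.
move/cvg_lim : c1 => <- //; move/cvg_lim : c2 => <- //.
by congr (limn _); apply/funext => n; rewrite finite_itv.
Qed.

Lemma exp_substitution_le w :
  (\int[mu]_(x in `]0%R, (A * expR (c * w))%R]) (G x)%:E = \int[mu]_(x in `]-oo, w]) (H x)%:E)%E.
Proof.
apply: (@limit_itv (fun n => w - n%:R) (fun => w)) => //.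
- by move=> n; rewrite gerBl.
- by move=> m n mn; rewrite lerD2l lerN2 ler_nat.
- apply/seteqP; split => [x [n _]|x] /=; rewrite !in_itv/= => /andP[h1 h2].
    by rewrite h2 (lt_le_trans _ h1) ?F0.
  have [n /(le_trans (ler_norm _)) hn] := normr_le_nat (w - ln (x / A) / c).
  exists n => //=; rewrite in_itv/= h2 andbT (FK h1) (le_mono incF); lra.
- apply/seteqP; split => [x [n _]|x] /=; rewrite !in_itv/=; first by move=> /andP[].
  move=> xw; have [n /(le_trans (ler_norm _)) hn] := normr_le_nat (w - x).
  by exists n => //=; rewrite in_itv/= xw andbT; lra.
Qed.

Lemma exp_substitution :
  (\int[mu]_(x in `]0%R, +oo[) (G x)%:E = \int[mu]_x (H x)%:E)%E.
Proof.
apply: (@limit_itv (fun n => - n%:R) (fun n => n%:R)) => //.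
- by move=> n; rewrite (@le_trans _ _ 0)// ?oppr_le0.
- by move=> m n mn; rewrite lerN2 ler_nat.
- by move=> m n mn; rewrite ler_nat.
- apply/seteqP; split => [x [n _]|x] /=; rewrite !in_itv/= ?andbT.
    by move=> /andP[h1 h2]; rewrite (lt_le_trans _ h1) ?F0.
  move=> x0; have [n] := normr_le_nat (ln (x / A) / c).
  rewrite ler_norml => /andP[h1 h2]; exists n => //=; rewrite in_itv/=.
  by rewrite {1 2}(FK x0) !(le_mono incF) h1.
- apply/seteqP; split => // x _.
  by have [n hn] := normr_le_nat x; exists n => //=; rewrite in_itv/= -ler_norml.
Qed.

End exp_substitution.

(** By symmetry the integral is twice that over the half-line, where the function is [r^-1] times
    the exponential density. It provides the dominating function for the limits in [nu]. *)
Lemma integrable_expRN_norm (r : R) : 0 < r ->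
  mu.-integrable [set: R] (EFin \o (fun x => expR (- (r * `|x|)))).
Proof.
move=> r0; have c : continuous (fun x : R => expR (- (r * `|x|))).
  move=> x; apply: (@continuous_comp _ _ _ (fun x : R => - (r * `|x|)) expR); last exact: continuous_expR.
  by apply: cvgN; apply: cvgM; [exact: cvg_cst|exact: norm_continuous].
apply/integrableP; split.
  by apply/measurable_EFinP; exact: continuous_measurable_fun.
under eq_integral do rewrite /= ger0_norm ?expR_ge0//.
rewrite ge0_symfun_integralT//=; last by move=> x; rewrite /= normrN.
rewrite lte_mul_pinfty//.
have -> : [set x : R | 0 <= x] = `[0, +oo[%classic.
  by apply/seteqP; split => x /=; rewrite in_itv/= andbT.
have -> : (\int[mu]_(x in `[0%R, +oo[) (expR (- (r * `|x|)))%:E =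
           \int[mu]_(x in `[0%R, +oo[) (r^-1%:E * (exponential_pdf r x)%:E))%E.
  apply: eq_integral => x; rewrite inE/= in_itv/= andbT => x0.
  by rewrite exponential_pdfE// ger0_norm// -EFinM mulKf ?gt_eqF// mulNr.
have mpdf (D : set R) : measurable_fun D (EFin \o exponential_pdf r).
  by apply/measurable_EFinP; apply: measurable_funTS; exact: measurable_exponential_pdf.
rewrite ge0_integralZl//; [|exact: mpdf| |].
- rewrite lte_mul_pinfty ?lee_fin ?invr_ge0 1?ltW//.
  apply: (@le_lt_trans _ _ 1%E); last exact: ltry.
  rewrite -(@integral_exponential_pdf R r)// ge0_subset_integral//; first exact: mpdf.
  by move=> x _; rewrite lee_fin exponential_pdf_ge0// ltW.
- by move=> x _; rewrite lee_fin exponential_pdf_ge0// ltW.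
- by rewrite lee_fin invr_ge0 ltW.
Qed.

Lemma ge0_integral_translation (G : R -> R) (d : R) :
  continuous G -> (forall x, 0 <= G x) ->
  (\int[mu]_x (G x)%:E = \int[mu]_x (G (x + d))%:E)%E.
Proof.
move=> cG G0; pose F (x : R) := x + d.
have dF (x : R) : is_derive x 1 F 1.
  have -> : F = @id R + cst d by [].
  by apply: is_derive_eq; rewrite addr0.
have F' : F^`()%classic = cst 1.
  by apply/funext => x; rewrite derive1E; have [_ ->] := dF x.
rewrite (@increasing_ge0_integration_by_substitutionT _ F G)//.
- by apply: eq_integral => x _; rewrite !fctE F' /= mulr1.
- by move=> x y xy; rewrite /F ltrD2r.
- by rewrite F' => x; exact: cst_continuous.
- by rewrite F'; exact: is_cvg_cst.
- by rewrite F'; exact: is_cvg_cst.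
- exact: cvg_addrr_Ny.
- exact: cvg_addrr.
Qed.

End Substitution.

(** * The normal distribution *)

Section Normal.
Context {R : realType}.
Notation mu := (@lebesgue_measure R).

(** Serves both densities, [phi] and [logchi nu]: pointwise bounds on them give monotonicity and
    Lipschitz bounds for the distribution functions. *)
Lemma Rintegral_Nyc_increment (f : R -> R) (a b m M : R) :
  mu.-integrable [set: R] (EFin \o f) -> a <= b ->
  (forall x, a < x <= b -> m <= f x <= M) ->
  m * (b - a) <= Rintegral mu `]-oo, b] f - Rintegral mu `]-oo, a] f <= M * (b - a).
Proof.
move=> fi ab mfM.
have fiS (D : set R) : measurable D -> mu.-integrable D (EFin \o f).
  by move=> mD; apply: integrableS fi.
rewrite Rintegral_itvB ?bnd_simp//; last exact: fiS.
have mab : mu `]a, b] = (b - a)%:E.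
  rewrite lebesgue_measure_itv/= lte_fin; case: ltgtP ab => // -> _.
  by rewrite subrr.
have ci k : mu.-integrable `]a, b] (EFin \o cst k).
  apply: measurable_bounded_integrable => //; first exact: (eq_ind_r (fun z => (z < +oo)%E) (ltry _) mab).
  exact: bounded_cst.
have cE k : Rintegral mu `]a, b] (cst k) = k * (b - a).
  by rewrite Rintegral_cst//; congr (_ * _); exact: (congr1 fine mab).
by rewrite -!cE; apply/andP; split; apply: le_Rintegral => //; try exact: fiS; try exact: ci;
  move=> x /=; rewrite in_itv/= => /mfM/andP[].
Qed.

Lemma phiE (x : R) : phi x = normal_peak 1 * expR (- (x ^+ 2 / 2)).
Proof. by rewrite /phi normal_pdfE ?oner_neq0// /normal_fun subr0 expr1n mulNr. Qed.

Lemma phi_gt0 (x : R) : 0 < phi x.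
Proof. by rewrite phiE mulr_gt0 ?expR_gt0// normal_peak_gt0 ?oner_neq0. Qed.

Lemma phi_ge0 (x : R) : 0 <= phi x. Proof. exact/ltW/phi_gt0. Qed.

Lemma phi_le1 (x : R) : phi x <= 1.
Proof.
apply: (le_trans (normal_pdf_ub _ _ (oner_neq0 _))).
rewrite /normal_peak expr1n mul1r.
have s1 : 1 <= Num.sqrt (pi *+ 2 : R).
  by rewrite -{1}sqrtr1 ler_wsqrtr// -mulr_natr; have := @pi_ge2 R; lra.
by rewrite invf_le1// (lt_le_trans ltr01).
Qed.

Lemma phiN (x : R) : phi (- x) = phi x.
Proof. by rewrite !phiE sqrrN. Qed.

Lemma continuous_phi : continuous (@phi R).
Proof. exact: continuous_normal_pdf (oner_neq0 _). Qed.

Lemma integrable_phi : mu.-integrable [set: R] (EFin \o @phi R).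
Proof. exact: integrable_normal_pdf. Qed.

Lemma integrable_phi_on (D : set R) : measurable D -> mu.-integrable D (EFin \o @phi R).
Proof. by move=> mD; apply: integrableS integrable_phi. Qed.

Lemma Rintegral_phi : Rintegral mu setT (@phi R) = 1.
Proof. by rewrite /Rintegral integral_normal_pdf. Qed.

Lemma phi_le (x y : R) : 0 <= x -> x <= y -> phi y <= phi x.
Proof.
move=> x0 xy; rewrite !phiE ler_pM2l ?normal_peak_gt0 ?oner_neq0// ler_expR lerN2.
by rewrite ler_pM2r// ler_sqr// nnegrE (le_trans x0).
Qed.

Lemma PhiN_tail (a : R) : Phi (- a) = Rintegral mu `[a, +oo[ (@phi R).
Proof.
rewrite /Phi /Rintegral /leb ge0_integration_by_substitutionNy.
- by congr fine; apply: eq_integral => x _; rewrite /= phiN.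
- by apply: continuous_subspaceT; exact: continuous_phi.
- by move=> x _; exact: phi_ge0.
Qed.

Lemma PhiD_PhiN (a : R) : Phi a + Phi (- a) = 1.
Proof.
rewrite PhiN_tail -Rintegral_itv_obnd_cbnd; last exact: integrable_phi_on.
have : Rintegral mu (`]-oo, +oo[%classic) (@phi R) - Rintegral mu `]-oo, a] (@phi R)
    = Rintegral mu `]a, +oo[ (@phi R).
  by apply: Rintegral_itvB; rewrite ?bnd_simp//; exact: integrable_phi_on.
by rewrite set_itvNyy Rintegral_phi /Phi /leb => <-; rewrite addrC subrK.
Qed.

Lemma Phi0 : Phi (0 : R) = 2^-1.
Proof. by have := PhiD_PhiN 0; rewrite oppr0; lra. Qed.

Lemma Phi_increment (a b m M : R) : a <= b ->
  (forall x, a < x <= b -> m <= phi x <= M) ->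
  m * (b - a) <= Phi b - Phi a <= M * (b - a).
Proof. exact: Rintegral_Nyc_increment integrable_phi. Qed.

Lemma Phi_lt (a b : R) : a < b -> Phi a < Phi b.
Proof.
(* As [phi] decreases in the absolute value, [phi c] is a positive lower bound for it on the
   interval. *)
move=> ab; pose c := Num.max `|a| `|b|.
have /andP[h _] : phi c * (b - a) <= Phi b - Phi a <= 1 * (b - a).
  apply: Phi_increment; first exact: ltW.
  move=> x /andP[ax xb]; rewrite phi_le1 andbT.
  have xc : `|x| <= c.
    rewrite le_max; have [x0|x0] := leP 0 x; apply/orP; [right|left].
      by rewrite !ger0_norm// (le_trans x0).
    by rewrite !ltr0_norm ?lerN2// ?(lt_trans ax)// ltW.
  have -> : phi x = phi `|x| by have [x0|/ltW x0] := leP 0 x; [rewrite ger0_norm|rewrite ler0_norm// phiN].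
  exact: phi_le.
have p : 0 < phi c * (b - a) by rewrite mulr_gt0 ?phi_gt0 ?subr_gt0.
by rewrite -subr_gt0; exact: lt_le_trans h.
Qed.

Lemma Phi_le (a b : R) : a <= b -> Phi a <= Phi b.
Proof. by rewrite le_eqVlt => /predU1P[->//|/Phi_lt/ltW]. Qed.

Lemma Phi_ge0 (a : R) : 0 <= Phi a.
Proof. by apply: Rintegral_ge0 => x _; exact: phi_ge0. Qed.

Lemma Phi_gt0 (a : R) : 0 < Phi a.
Proof. by apply: le_lt_trans (Phi_ge0 (a - 1)) _; apply: Phi_lt; lra. Qed.

Lemma Phi_le1 (a : R) : Phi a <= 1.
Proof. by have := PhiD_PhiN a; have := Phi_ge0 (- a); lra. Qed.

Lemma norm_Phi (a : R) : `|Phi a| = Phi a.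
Proof. by rewrite ger0_norm// Phi_ge0. Qed.

Lemma Phi_lipschitz (a b : R) : a <= b -> Phi b - Phi a <= b - a.
Proof.
move=> ab; have /andP[_] : 0 * (b - a) <= Phi b - Phi a <= 1 * (b - a).
  by apply: Phi_increment => // x _; rewrite phi_ge0 phi_le1.
by rewrite mul1r.
Qed.

Lemma Phi_dist (a b : R) : `|Phi a - Phi b| <= `|a - b|.
Proof.
wlog ab : a b / b <= a.
  move=> H; have [/H//|/ltW/H] := leP b a.
  by rewrite distrC (distrC b).
by rewrite !ger0_norm ?subr_ge0 ?Phi_le//; exact: Phi_lipschitz.
Qed.

Lemma continuous_Phi : continuous (@Phi R).
Proof.
move=> x; apply/cvgrPdist_le => e e0; near=> y.
apply: (le_trans (Phi_dist _ _)).
by near: y; apply: cvgr_dist_le => //; exact: cvg_id.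
Unshelve. all: end_near. Qed.

(** The tail beyond [b] contains the unit interval from [b] to [b + 1]. The bound is crude, but its
    reciprocal is explicit and, after a contraction of the argument, integrable against [phi]. *)
Lemma PhiN_lower (b : R) : 0 <= b -> phi (b + 1) <= Phi (- b).
Proof.
move=> b0; have /andP[h _] : phi (b + 1) * (- b - - (b + 1)) <= Phi (- b) - Phi (- (b + 1)) <= 1 * (- b - - (b + 1)).
  apply: Phi_increment; first lra.
  move=> x /andP[h1 h2]; rewrite phi_le1 andbT -(phiN x); apply: phi_le; lra.
have := Phi_ge0 (- (b + 1)); move: h.
by rewrite (_ : - b - - (b + 1) = 1) ?mulr1; lra.
Qed.

Lemma PhiN_diff_lower (a b : R) : 0 <= a -> a <= b ->
  (b - a) * phi b <= Phi (- a) - Phi (- b).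
Proof.
move=> a0 ab; have /andP[h _] : phi b * (- a - - b) <= Phi (- a) - Phi (- b) <= 1 * (- a - - b).
  apply: Phi_increment; first lra.
  move=> x /andP[h1 h2]; rewrite phi_le1 andbT -(phiN x); apply: phi_le; lra.
by rewrite mulrC; have -> : b - a = - a - - b by ring.
Qed.

(* Comparing [phi] with its image under the affine maps of slope [1] and [a / b] sending [a] to [b] gives the two bounds. *)
Lemma PhiN_ratio (a b : R) : 0 < a -> a <= b ->
  a / b * expR (- ((b ^+ 2 - a ^+ 2) / 2)) * Phi (- a) <= Phi (- b) <=
  expR (- ((b ^+ 2 - a ^+ 2) / 2)) * Phi (- a).
Proof.
move=> a0 ab; have b0 := lt_le_trans a0 ab.
set E := expR _.
have sub r : 0 < r -> Phi (- b) = Rintegral mu `[a, +oo[ (fun x => phi (b + r * (x - a)) * r).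
  move=> r0; rewrite PhiN_tail /Rintegral (@affine_substitutiony R (@phi R) a b r)//.
    exact: continuous_phi.
  exact: phi_ge0.
have int r : 0 < r -> mu.-integrable `[a, +oo[ (EFin \o (fun x => phi (b + r * (x - a)) * r)).
  move=> r0; apply/integrableP; split.
    apply/measurable_EFinP; apply: measurable_funTS; apply: continuous_measurable_fun => x.
    apply: cvgM; last exact: cvg_cst.
    apply: (@continuous_comp _ _ _ (fun x => b + r * (x - a)) (@phi R)); last exact: continuous_phi.
    apply: cvgD; first exact: cvg_cst.
    apply: cvgM; first exact: cvg_cst.
    by apply: cvgB; [exact: cvg_id|exact: cvg_cst].
  have /integrableP[_] := @integrable_phi_on `[b, +oo[ (measurable_itv _).
  under eq_integral do rewrite /= ger0_norm ?phi_ge0//.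
  rewrite (@affine_substitutiony R (@phi R) a b r)//; [|exact: continuous_phi|exact: phi_ge0].
  by under [in X in _ -> X]eq_integral do rewrite /= ger0_norm ?mulr_ge0 ?phi_ge0 1?ltW//.
have iphi : mu.-integrable `[a, +oo[ (EFin \o @phi R) by exact: integrable_phi_on.
have iZ k : mu.-integrable `[a, +oo[ (EFin \o (fun x => k * phi x)).
  have h : mu.-integrable `[a, +oo[ (fun x => k%:E * (EFin \o @phi R) x)%E by exact: integrableZl.
  exact: h.
have ZE k : k * Phi (- a) = Rintegral mu `[a, +oo[ (fun x => k * phi x).
  by rewrite RintegralZl// PhiN_tail.
apply/andP; split.
- rewrite ZE (sub (a / b)) ?divr_gt0//; apply: le_Rintegral => //.
    exact/int/divr_gt0.
  move=> x /=; rewrite in_itv/= andbT => ax; rewrite -mulrA mulrC ler_pM2r ?divr_gt0//.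
  rewrite !phiE mulrCA ler_pM2l ?normal_peak_gt0 ?oner_neq0// -expRD ler_expR.
  (* The slope [a / b] makes the cross term equal to that of [x ^ 2] expanded at [a], so only the
     quadratic terms remain to be compared. *)
  have h : (a / b * (x - a)) ^+ 2 <= (x - a) ^+ 2.
    rewrite exprMn ler_piMl ?sqr_ge0// expr_le1// ?ler_pdivrMr ?mul1r//.
    by rewrite divr_ge0// ltW.
  have e : b * (a / b * (x - a)) = a * (x - a) by field; rewrite gt_eqF.
  nra.
- rewrite ZE (sub 1)//; apply: le_Rintegral => //; first exact: int.
  move=> x /=; rewrite in_itv/= andbT => ax; rewrite mulr1 mul1r.
  rewrite !phiE mulrCA ler_pM2l ?normal_peak_gt0 ?oner_neq0// -expRD ler_expR.
  nra.
Qed.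

End Normal.

(** * Bounds on the exponential *)

Section Exponential.
Context {R : realType}.

Let MVT0 (f g : R -> R) (v : R) :
  (forall x : R, is_derive x 1 f (g x)) -> f 0 = 0 ->
  exists2 x, f v = g x * v & v = 0 \/ 0 < x * v.
Proof.
move=> df f0.
have cf (D : set R) : {within D, continuous f}.
  apply: continuous_subspaceT => x.
  by apply/differentiable_continuous/derivable1_diffP; have [] := df x.
have [v0|v0|->] := ltgtP v 0; last by exists 0; [rewrite f0 mulr0|left].
- have [x + e] := MVT v0 (fun x _ => df x) (cf _).
  rewrite in_itv/= => /andP[_ x0]; exists x; last by right; rewrite nmulr_rgt0.
  by move: e; rewrite f0; lra.
- have [x + e] := MVT v0 (fun x _ => df x) (cf _).
  rewrite in_itv/= => /andP[x0 _]; exists x; last by right; rewrite mulr_gt0.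
  by move: e; rewrite f0; lra.
Qed.

(** This is the tangent of slope [1 + eta], touching at [ln (1 + eta)], weakened by
    [ln (1 + eta) <= eta]. *)
Lemma expR_ge_tangent (v eta : R) : `|eta| < 1 -> 1 + v + eta * v - eta ^+ 2 <= expR v.
Proof.
rewrite ltr_norml => /andP[h1 h2].
have e1 : 0 < 1 + eta by lra.
have l : ln (1 + eta) <= eta by apply: le_ln1Dx; lra.
have -> : expR v = (1 + eta) * expR (v - ln (1 + eta)).
  by rewrite -{1}(lnK (x := 1 + eta)) ?posrE// -expRD; congr expR; ring.
have : (1 + eta) * (1 + (v - ln (1 + eta))) <= (1 + eta) * expR (v - ln (1 + eta)).
  by rewrite ler_pM2l// expR_ge1Dx.
apply: le_trans; nra.
Qed.

(** Taylor remainders: [h2] has the nonnegative derivative [expR v - (1 + v)], hence the sign of its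
    argument; [h3] has derivative [h2], hence is nonnegative. *)
Let h2 (v : R) := expR v - (1 + v + v ^+ 2 / 2).

Let h3 (v : R) := expR v - (1 + v + v ^+ 2 / 2 + v ^+ 3 / 6).

Let h2_sgn v : 0 <= v * h2 v.
Proof.
have d2 (x : R) : is_derive x 1 h2 (expR x - (1 + x)).
  have -> : h2 = expR - (cst 1 + @id R + (2^-1 : R) \*: (@id R ^+ 2)).
    by apply/funext => y; rewrite /h2 !fctE /GRing.scale/= mulrC.
  apply: is_derive_eq.
  by rewrite /GRing.scale /=; field.
have e0 : h2 0 = 0 by rewrite /h2 expR0 expr0n /=; ring.
have [x -> _] := MVT0 v d2 e0.
have := expR_ge1Dx x; rewrite -subr_ge0 => ?.
by rewrite mulrCA mulr_ge0// -expr2 sqr_ge0.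
Qed.

Let h3_ge0 v : 0 <= h3 v.
Proof.
have d3 (x : R) : is_derive x 1 h3 (h2 x).
  have -> : h3 = expR - (cst 1 + @id R + (2^-1 : R) \*: (@id R ^+ 2) + (6^-1 : R) \*: (@id R ^+ 3)).
    apply/funext => y; rewrite /h3 !fctE /GRing.scale/= [_ ^+ 2 / 2]mulrC [_ ^+ 3 / 6]mulrC. done.
  apply: is_derive_eq.
  by rewrite /h2 /GRing.scale /=; field.
have e0 : h3 0 = 0 by rewrite /h3 expR0 !expr0n /=; ring.
have [x -> [->|xv]] := MVT0 v d3 e0; first by rewrite mulr0.
have x2 : 0 < x ^+ 2 by rewrite lt_neqAle sqr_ge0 eq_sym sqrf_eq0 andbT; apply/eqP => x0; move: xv; rewrite x0 mul0r ltxx.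
have e : x ^+ 2 * (h2 x * v) = (x * h2 x) * (x * v) by rewrite expr2 mulrACA !mulrA.
rewrite -(pmulr_rge0 _ x2) e.
by rewrite mulr_ge0 ?h2_sgn// ltW.
Qed.

Lemma expR_taylor2 (v : R) : `|v| <= 1 -> `|expR v - 1 - v - v ^+ 2 / 2| <= `|v| ^+ 3.
Proof.
have h2v := h2_sgn v; have h3v := h3_ge0 v; have h3N := h3_ge0 (- v).
have EE : expR v * expR (- v) = 1 by rewrite -expRD subrr expR0.
have E0 := expR_gt0 v.
have [->|v0] := eqVneq v 0.
  by rewrite normr0 expR0 !expr0n /= !subr0 subrr mul0r subr0 normr0.
move: h2v h3v h3N; rewrite /h2 /h3; move: (expR v) (expR (- v)) EE E0 => E E' EE E0.
have [vp|vn] := ltP 0 v.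
- rewrite (gtr0_norm vp) pmulr_rge0// => h2v h3v h3N v1.
  (* For [v > 0] an upper bound on [expR v] comes from a positive lower bound on [expR (- v)], here
     its cubic Taylor polynomial. *)
  pose p := 1 - v + v ^+ 2 / 2 - v ^+ 3 / 6.
  have p0 : 0 < p by rewrite /p; nra.
  have pE : p <= E' by move: h3N; rewrite /p sqrrN exprNn; lra.
  have Ep : E * p <= 1 by rewrite -EE ler_pM2l.
  have up : E <= 1 + v + v ^+ 2 / 2 + v ^+ 3.
    rewrite -(ler_pM2r p0); apply: (le_trans Ep); rewrite -subr_ge0.
    have -> : (1 + v + v ^+ 2 / 2 + v ^+ 3) * p - 1 =
        v ^+ 3 * (5 / 6 - 11 / 12 * v + 5 / 12 * v ^+ 2 - 1 / 6 * v ^+ 3) by rewrite /p; field.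
    rewrite mulr_ge0 ?exprn_ge0 ?ltW//.
    have v2 : v ^+ 3 <= v ^+ 2 by rewrite exprS ler_piMl ?sqr_ge0.
    nra.
  rewrite ger0_norm; lra.
- have {}vn : v < 0 by rewrite lt_neqAle v0.
  rewrite (ltr0_norm vn) nmulr_rge0// => h2v h3v _ v1.
  rewrite ler0_norm; last lra.
  have : 0 <= (- v) ^+ 3 by rewrite exprn_ge0// oppr_ge0 ltW.
  rewrite exprNn; lra.
Qed.

End Exponential.

(** * The chi distribution in logarithmic scale *)

Section Generic.

Lemma Rintegral_dominated_cvg d (T : measurableType d) (R : realType)
    (mu : {measure set T -> \bar R}) (D : set T) (f_ : nat -> T -> R) (f h : T -> R) :
  measurable D -> (forall n, measurable_fun D (f_ n)) ->
  mu.-integrable D (EFin \o h) ->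
  (forall n x, D x -> `|f_ n x| <= h x) ->
  (forall x, D x -> f_ ^~ x @ \oo --> f x) ->
  Rintegral mu D (f_ n) @[n --> \oo] --> Rintegral mu D f.
Proof.
move=> mD mf ih fh ff.
have cf x : D x -> (fun n => (f_ n x)%:E) @ \oo --> (f x)%:E.
  by move=> Dx; apply: cvg_EFin; [exact: nearW|exact: ff].
have mfE n : measurable_fun D (EFin \o f_ n) by apply/measurable_EFinP; exact: mf.
have := @dominated_cvg _ _ _ mu D mD (fun n => EFin \o f_ n) (EFin \o f) (EFin \o h) mfE cf.
move=> /(_ (fun _ _ => isT) ih) H.
apply: fine_cvg; rewrite fineK; last first.
  apply: integrable_fin_num => //.
  have := @dominated_convergence _ _ _ mu D mD (fun n => EFin \o f_ n) (EFin \o f) (EFin \o h) mfE.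
  case=> //.
  - exact: (emeasurable_fun_cvg _ _ mfE cf).
  - exact: aeW.
  - by apply: aeW => x n Dx; rewrite lee_fin fh.
by apply: H => n x Dx; rewrite lee_fin fh.
Qed.

Lemma Rintegral_gt0 (R : realType) (f : R -> R) :
  (@lebesgue_measure R).-integrable [set: R] (EFin \o f) -> (forall x, 0 < f x) ->
  0 < Rintegral (@lebesgue_measure R) setT f.
Proof.
move=> fi f0; rewrite lt_neqAle Rintegral_ge0 ?andbT => [|x _]; last exact/ltW.
apply/eqP => /esym i0.
have mf : measurable_fun [set: R] (EFin \o f) by exact: (measurable_int lebesgue_measure).
have : (\int[lebesgue_measure]_(x in [set: R]) `|(EFin \o f) x| = 0)%E.
  under eq_integral do rewrite /= ger0_norm ?(ltW (f0 _))//.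
  have := integrable_fin_num measurableT fi.
  by move=> /fineK; rewrite -/(Rintegral _ _ _) i0 => <-.
move/(ae_eq_integral_abs lebesgue_measure measurableT mf) => [N [mN N0 sub]].
have NT : N = setT.
  by apply/seteqP; split => // x _; apply: sub => /= /(_ I) -[]; have := f0 x; lra.
move: N0; rewrite NT -set_itvNyy => N0.
have := @lebesgue_measure_itv R `]-oo, +oo[; rewrite N0/= => /eqP.
by rewrite eq_sym.
Qed.

End Generic.

Section LogChi.
Context {R : realType}.
Notation mu := (@lebesgue_measure R).

(** The asymptotic standard deviation of [ln (S ^ 2)]. It satisfies [nu / 2 * c ^ 2 = 1], so the
    exponent of [logchi] starts with [- x ^ 2 / 2] for every [nu]. *)
Definition logchi_scale (nu : nat) : R := Num.sqrt (2 / nu%:R).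

(* The density, up to the factor [logchi_mass nu], of [x] where [S = expR (logchi_scale nu / 2 * x)]. *)
Definition logchi (nu : nat) (x : R) : R :=
  expR (- (nu%:R / 2 * (expR (logchi_scale nu * x) - 1 - logchi_scale nu * x))).

Definition logchi_mass (nu : nat) : R := Rintegral mu setT (logchi nu).

Section fixed.
Variables (nu : nat) (nu0 : (0 < nu)%N).
Notation c := (logchi_scale nu).

Let nuR : 0 < nu%:R :> R. Proof. by rewrite ltr0n. Qed.

Lemma logchi_scale_gt0 : 0 < c.
Proof. by rewrite sqrtr_gt0 divr_gt0. Qed.

Lemma sqr_logchi_scale : c ^+ 2 = 2 / nu%:R.
Proof. by rewrite sqr_sqrtr// ltW// divr_gt0. Qed.

Let nuc : nu%:R / 2 * c ^+ 2 = 1.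
Proof. by rewrite sqr_logchi_scale; field; rewrite gt_eqF. Qed.

Lemma logchi_gt0 x : 0 < logchi nu x. Proof. exact: expR_gt0. Qed.

Lemma logchi_ge0 x : 0 <= logchi nu x. Proof. exact: expR_ge0. Qed.

Lemma logchi_le1 x : logchi nu x <= 1.
Proof.
rewrite -expR0 ler_expR oppr_le0 mulr_ge0 ?divr_ge0 ?(ltW nuR)//.
by have := expR_ge1Dx (c * x); lra.
Qed.

(** The tangent inequality with [eta = K c] or [- K c], according to the sign of [x]. The bound is
    free of [nu], which makes dominated convergence in [nu] possible. *)
Lemma logchi_le_exp K x : 0 <= K -> K * c < 1 -> logchi nu x <= expR (K ^+ 2 - K * `|x|).
Proof.
move=> K0 Kc; rewrite ler_expR.
have c0 := logchi_scale_gt0.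
have key eta : `|eta| < 1 ->
    nu%:R / 2 * (eta * (c * x) - eta ^+ 2) <= nu%:R / 2 * (expR (c * x) - 1 - c * x).
  by move=> /expR_ge_tangent -/(_ (c * x)) h; rewrite ler_pM2l ?divr_gt0//; lra.
have [x0|x0] := leP 0 x.
- have := key (K * c); rewrite ger0_norm ?mulr_ge0 ?(ltW c0)// => /(_ Kc).
  have -> : nu%:R / 2 * (K * c * (c * x) - (K * c) ^+ 2) = nu%:R / 2 * c ^+ 2 * (K * x - K ^+ 2) by ring.
  by rewrite nuc mul1r ger0_norm//; lra.
- have := key (- (K * c)); rewrite normrN ger0_norm ?mulr_ge0 ?(ltW c0)// => /(_ Kc).
  have -> : nu%:R / 2 * (- (K * c) * (c * x) - (- (K * c)) ^+ 2) = nu%:R / 2 * c ^+ 2 * (K * - x - K ^+ 2) by ring.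
  by rewrite nuc mul1r ltr0_norm//; lra.
Qed.

Lemma continuous_logchi : continuous (logchi nu).
Proof.
have cc : continuous (fun x : R => c * x).
  by move=> x; apply: cvgM; [exact: cvg_cst|exact: cvg_id].
move=> x; apply: (@continuous_comp _ _ _ (fun x => - (nu%:R / 2 * (expR (c * x) - 1 - c * x))) expR); last exact: continuous_expR.
apply: cvgN; apply: cvgM; first exact: cvg_cst.
apply: cvgB; last exact: cc.
apply: cvgB; last exact: cvg_cst.
by apply: (@continuous_comp _ _ _ (fun x => c * x) expR); [exact: cc|exact: continuous_expR].
Qed.

Lemma measurable_logchi (D : set R) : measurable_fun D (logchi nu).
Proof. by apply: measurable_funTS; apply: continuous_measurable_fun; exact: continuous_logchi. Qed.

Lemma integrable_logchi : mu.-integrable [set: R] (EFin \o logchi nu).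
Proof.
(* The rate [1 / 2] is admissible from [nu = 1] on, where [c] takes its largest value [sqrt 2]. *)
have c2 : 2^-1 * c < 1.
  suff : c < 2 by lra.
  rewrite -(ltr_pXn2r (n := 2)) ?nnegrE ?ltW ?logchi_scale_gt0// sqr_logchi_scale.
  rewrite ltr_pdivrMr//; have : 1 <= nu%:R :> R by rewrite ler1n.
  lra.
have h0 : 0 <= 2^-1 :> R by lra.
pose k := expR (2^-1 ^+ 2) : R.
pose h (x : R) := expR (- (2^-1 * `|x|)).
have hb x : logchi nu x <= k * h x by rewrite -expRD; exact: logchi_le_exp.
have ih : mu.-integrable [set: R] (fun x => (k%:E * (EFin \o h) x)%E).
  by apply: integrableZl => //; apply: integrable_expRN_norm; rewrite invr_gt0.
apply: le_integrable ih => //; first by apply/measurable_EFinP; exact: measurable_logchi.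
move=> x _ /=; rewrite lee_fin (ger0_norm (logchi_ge0 x)) ger0_norm; first exact: hb.
by rewrite mulr_ge0 ?expR_ge0.
Qed.

Lemma logchi_mass_gt0 : 0 < logchi_mass nu.
Proof. by apply: Rintegral_gt0; [exact: integrable_logchi|exact: logchi_gt0]. Qed.

Lemma integrable_logchiM (D : set R) (f : R -> R) (M : R) :
  measurable D -> continuous f -> (forall x, `|f x| <= M) ->
  mu.-integrable D (EFin \o (fun x => logchi nu x * f x)).
Proof.
move=> mD cf fM; apply: (@integrableS _ _ _ mu setT) => //.
apply: (@le_integrable _ _ _ mu _ _ _ (fun x => (M%:E * (EFin \o logchi nu) x)%E)) => //.
- apply/measurable_EFinP; apply: measurable_funM; first exact: measurable_logchi.
  exact: continuous_measurable_fun.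
- move=> x _ /=; rewrite lee_fin normrM normrM ger0_norm ?logchi_ge0// mulrC ler_wpM2r ?logchi_ge0//.
  by rewrite (le_trans (fM x))// ler_norm.
- by apply: integrableZl => //; exact: integrable_logchi.
Qed.

(** Since [S] increases with [x], this is [P (S <= expR (c / 2 * w))]. *)
Definition logchi_cdf (w : R) : R := Rintegral mu `]-oo, w] (logchi nu) / logchi_mass nu.

Lemma logchi_cdf_ge0 w : 0 <= logchi_cdf w.
Proof. by rewrite divr_ge0 ?(ltW logchi_mass_gt0)// Rintegral_ge0// => x _; exact: logchi_ge0. Qed.

(** The density is at most [1 / logchi_mass nu]. No scale carries an atom, so the undecided
    behaviour at the critical scale does not affect the limit. *)
Lemma logchi_cdf_increment a b : a <= b ->
  0 <= logchi_cdf b - logchi_cdf a <= (b - a) / logchi_mass nu.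
Proof.
move=> ab; have /andP[] := @Rintegral_Nyc_increment R _ a b 0 1 integrable_logchi ab
  (fun x _ => introT andP (conj (logchi_ge0 x) (logchi_le1 x))).
rewrite mul0r mul1r => h1 h2; rewrite /logchi_cdf -mulrBl.
by rewrite divr_ge0 ?(ltW logchi_mass_gt0)//= ler_pM2r// invr_gt0 logchi_mass_gt0.
Qed.

Lemma logchi_cdf_le a b : a <= b -> logchi_cdf a <= logchi_cdf b.
Proof. by move=> /logchi_cdf_increment/andP[]; rewrite subr_ge0. Qed.

End fixed.
End LogChi.

(** * Chi-square expectations in logarithmic scale *)

Section ChiSquare.
Context {R : realType}.
Notation mu := (@lebesgue_measure R).
Variables (nu : nat) (nu0 : (0 < nu)%N).
Notation c := (@logchi_scale R nu).

Let nuR : 0 < nu%:R :> R. Proof. by rewrite ltr0n. Qed.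
Let c0 : 0 < c. Proof. exact: logchi_scale_gt0. Qed.

Let ker (u : R) := expR ((nu%:R / 2 - 1) * ln u - u / 2).

Let kerE u : 0 < u -> chi2_kernel nu u = ker u.
Proof. by move=> u0; rewrite /chi2_kernel /powR gt_eqF// -expRD mulNr. Qed.

Let K0 := c * expR (nu%:R / 2 * ln nu%:R - nu%:R / 2).

Let K0_gt0 : 0 < K0. Proof. by rewrite mulr_gt0 ?expR_gt0. Qed.

Let ker_subst x :
  ker (nu%:R * expR (c * x)) * (nu%:R * (c * expR (c * x))) = K0 * logchi nu x.
Proof.
rewrite /ker lnM ?posrE ?expR_gt0// expRK.
have -> : nu%:R * (c * expR (c * x)) = c * expR (ln nu%:R + c * x).
  by rewrite expRD lnK ?posrE//; ring.
have e a b : expR a * (c * expR b) = c * expR (a + b) by rewrite expRD mulrCA.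
have e' a b : c * expR a * expR b = c * expR (a + b) by rewrite expRD mulrA.
by rewrite e /K0 e'; congr (_ * expR _); field.
Qed.

Let sqrt_subst x : Num.sqrt (nu%:R * expR (c * x) / nu%:R) = expR (c / 2 * x).
Proof.
rewrite mulrAC mulfV ?gt_eqF// mul1r.
have -> : c * x = c / 2 * x + c / 2 * x by field.
by rewrite expRD -expr2 sqrtr_sqr ger0_norm ?expR_ge0.
Qed.

Let cker : {in `]0, +oo[, continuous ker}.
Proof.
move=> u; rewrite in_itv/= andbT => u0.
apply: (@continuous_comp _ _ _ (fun u => (nu%:R / 2 - 1) * ln u - u / 2) expR); last exact: continuous_expR.
apply: cvgB; first by apply: cvgM; [exact: cvg_cst|exact: continuous_ln].
by apply: cvgM; [exact: cvg_id|exact: cvg_cst].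
Qed.

(** The substitution is [u = nu * expR (c * x)], whose Jacobian is proportional to [u] and absorbs
    the [- 1] in the power of the kernel; [K0] collects what is free of [x]. *)
Lemma Rintegral_chi2_kernel (f : R -> R) (M : R) : continuous f -> (forall s, 0 <= f s <= M) ->
  Rintegral mu `]0, +oo[ (fun u => chi2_kernel nu u * f (Num.sqrt (u / nu%:R))) =
  K0 * Rintegral mu setT (fun x => logchi nu x * f (expR (c / 2 * x))).
Proof.
move=> cf fM.
have cfe : continuous (fun x => f (expR (c / 2 * x))).
  move=> x; apply: (@continuous_comp _ _ _ (fun x => expR (c / 2 * x)) f); last exact: cf.
  apply: (@continuous_comp _ _ _ (fun x => c / 2 * x) expR); last exact: continuous_expR.
  by apply: cvgM; [exact: cvg_cst|exact: cvg_id].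
have cs : continuous (fun u : R => f (Num.sqrt (u / nu%:R))).
  move=> u; apply: (@continuous_comp _ _ _ (fun u : R => Num.sqrt (u / nu%:R)) f); last exact: cf.
  apply: (@continuous_comp _ _ _ (fun u : R => u / nu%:R) Num.sqrt); last exact: sqrt_continuous.
  by apply: cvgM; [exact: cvg_id|exact: cvg_cst].
rewrite -RintegralZl//; last first.
  apply: (@integrable_logchiM _ _ nu0 _ _ M) => // x.
  by have /andP[? ?] := fM (expR (c / 2 * x)); rewrite ger0_norm.
rewrite (@eq_Rintegral _ _ _ mu _ (fun u => ker u * f (Num.sqrt (u / nu%:R)))); last first.
  by move=> u; rewrite inE/= in_itv/= andbT => u0; rewrite kerE.
rewrite /Rintegral (@exp_substitution R nu%:R c)//.
- congr fine; apply: eq_integral => x _; congr EFin.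
  by rewrite sqrt_subst -mulrA (mulrC (f _)) !mulrA -ker_subst !mulrA.
- move=> u u0; apply: cvgM; first exact: cker.
  exact: cs.
- move=> u u0; rewrite mulr_ge0 ?expR_ge0//.
  by have /andP[] := fM (Num.sqrt (u / nu%:R)).
Qed.

Let chi2_constE : @chi2_const R nu = K0 * logchi_mass nu.
Proof.
have := @Rintegral_chi2_kernel (cst 1) 1 (@cst_continuous _ _ _) (fun _ => introT andP (conj ler01 (lexx 1))).
have e : (fun x : R => logchi nu x * 1) = logchi nu by apply/funext => x; rewrite mulr1.
by rewrite e -/(logchi_mass nu) => <-; apply: eq_Rintegral => u _; rewrite mulr1.
Qed.

Let chi2_const_gt0 : 0 < @chi2_const R nu.
Proof. by rewrite chi2_constE mulr_gt0// logchi_mass_gt0. Qed.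

Lemma ES_logchi (f : R -> R) (M : R) : continuous f -> (forall s, 0 <= f s <= M) ->
  ES nu f = Rintegral mu setT (fun x => logchi nu x * f (expR (c / 2 * x))) / logchi_mass nu.
Proof.
move=> cf fM; pose k := (@chi2_const R nu)^-1.
have k0 : 0 < k by rewrite invr_gt0.
have -> : ES nu f = Rintegral mu `]0, +oo[ (fun u => chi2_kernel nu u * (k * f (Num.sqrt (u / nu%:R)))).
  by apply: eq_Rintegral => u _; rewrite mulrA.
rewrite (@Rintegral_chi2_kernel (fun s => k * f s) (k * M)).
- have -> : (fun x => logchi nu x * (k * f (expR (c / 2 * x)))) =
            (fun x => k * (logchi nu x * f (expR (c / 2 * x)))).
    by apply/funext => x; rewrite mulrCA.
  rewrite RintegralZl//; last first.
    apply: (@integrable_logchiM _ _ nu0 _ _ M) => // [x|x]; last first.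
      by have /andP[? ?] := fM (expR (c / 2 * x)); rewrite ger0_norm.
    apply: (@continuous_comp _ _ _ (fun x => expR (c / 2 * x)) f); last exact: cf.
    apply: (@continuous_comp _ _ _ (fun x => c / 2 * x) expR); last exact: continuous_expR.
    by apply: cvgM; [exact: cvg_cst|exact: cvg_id].
  rewrite mulrA /k chi2_constE invfM mulrA mulfV ?gt_eqF// mul1r mulrC//.
- by move=> x; apply: cvgM; [exact: cvg_cst|exact: cf].
- by move=> s; have /andP[h1 h2] := fM s; rewrite mulr_ge0 ?(ltW k0)//= ler_pM2l.
Qed.

Let d (u : R) := chi2_kernel nu u / @chi2_const R nu.

Let d_ge0 u : 0 <= d u.
Proof. by rewrite divr_ge0 ?(ltW chi2_const_gt0)// mulr_ge0 ?powR_ge0 ?expR_ge0. Qed.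

Let Rintegral_d : Rintegral mu `]0, +oo[ d = 1.
Proof.
have := @ES_logchi (cst 1) 1 (@cst_continuous _ _ _) (fun _ => introT andP (conj ler01 (lexx 1))).
have e : (fun x : R => logchi nu x * 1) = logchi nu by apply/funext => x; rewrite mulr1.
rewrite e -/(logchi_mass nu) mulfV ?gt_eqF ?logchi_mass_gt0// => <-.
by apply: eq_Rintegral => u _; rewrite mulr1.
Qed.

Let integrable_d : mu.-integrable `]0, +oo[ (EFin \o d).
Proof.
have md : measurable_fun `](0 : R), +oo[ d.
  apply: (@eq_measurable_fun _ _ _ _ _ (fun u => ker u / @chi2_const R nu)).
    by move=> u; rewrite inE/= in_itv/= andbT => u0; rewrite /d kerE.
  apply: measurable_funM => //.
  apply: open_continuous_measurable_fun; first exact: interval_open.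
  by move=> u; rewrite inE => /cker.
apply/integrableP; split; first exact/measurable_EFinP.
under eq_integral do rewrite /= ger0_norm ?d_ge0//.
have := Rintegral_d; rewrite /Rintegral.
case: (\int[mu]_(x in `]0%R, +oo[) (d x)%:E)%E => [r|/=|/=] //= ; rewrite ?ltry// => /esym/eqP.
by rewrite oner_eq0.
Qed.

Let B w : set R := `]0, nu%:R * expR (c * w)]%classic.

Let Rintegral_d_le w : Rintegral mu (B w) d = logchi_cdf nu w.
Proof.
have -> : Rintegral mu (B w) d =
    Rintegral mu (B w) (fun u => (@chi2_const R nu)^-1 * ker u).
  apply: eq_Rintegral => u; rewrite /B inE/= in_itv/= => /andP[u0 _].
  by rewrite /d kerE// mulrC.
rewrite /Rintegral /B (@exp_substitution_le R nu%:R c)//.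
- have -> : (\int[mu]_(x in `]-oo, w]) ((@chi2_const R nu)^-1 * ker (nu%:R * expR (c * x)) * (nu%:R * (c * expR (c * x))))%:E)%E
    = (\int[mu]_(x in `]-oo, w]) ((logchi_mass nu)^-1 * logchi nu x)%:E)%E.
    apply: eq_integral => x _; congr EFin.
    by rewrite -mulrA ker_subst chi2_constE invfM -mulrA [X in _ * X]mulrCA mulKf ?gt_eqF.
  transitivity (Rintegral mu `]-oo, w] (fun x => (logchi_mass nu)^-1 * logchi nu x)) => //.
  rewrite RintegralZl//; first by rewrite mulrC.
  by apply: integrableS (integrable_logchi nu0).
- by move=> u u0; apply: cvgM; [exact: cvg_cst|exact: cker].
- by move=> u u0; rewrite mulr_ge0 ?expR_ge0// invr_ge0 ltW.
Qed.

Let le_sqrt w u : 0 < u -> (Num.sqrt (u / nu%:R) <= expR (c / 2 * w)) = (u <= nu%:R * expR (c * w)).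
Proof.
move=> u0; rewrite -sqrt_subst ler_sqrt ?divr_ge0 ?mulr_ge0 ?expR_ge0 ?(ltW nuR)//.
by rewrite ler_pM2r ?invr_gt0.
Qed.

(** The density times the function of [S] equal to [p + q] up to the scale [expR (c / 2 * w)] and to
    [q] beyond. The conditional false discovery rate is integrated over [S] only by comparison with
    such functions. *)
Let step w p q u := p * (d u * \1_(B w) u) + q * d u.

Let integrable_indic_d w : mu.-integrable `]0, +oo[ (EFin \o (fun u => d u * \1_(B w) u)).
Proof.
apply: (@le_integrable _ _ _ mu _ _ _ (EFin \o d)) => //.
- apply/measurable_EFinP; apply: measurable_funM; last by apply: measurable_indic; exact: measurable_itv.
  by apply/measurable_EFinP; exact: (measurable_int mu).
- move=> u _; rewrite /= lee_fin normrM (ger0_norm (d_ge0 u)) ler_piMr ?d_ge0//.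
  by rewrite indicE; case: (_ \in _); rewrite ?normr1 ?normr0.
Qed.

Let integrable_step w p q : mu.-integrable `]0, +oo[ (EFin \o step w p q).
Proof.
have h1 : mu.-integrable `]0, +oo[ (fun u => p%:E * (EFin \o (fun u => (d u * \1_(B w) u)%R)) u)%E.
  by apply: integrableZl.
have h2 : mu.-integrable `]0, +oo[ (fun u => q%:E * (EFin \o d) u)%E by apply: integrableZl.
exact: (integrableD _ h1 h2).
Qed.

Let step_bounds w p q u : 0 <= p -> 0 <= q -> `|step w p q u| <= (p + q) * d u.
Proof.
move=> p0 q0; rewrite /step; move: (d u) (d_ge0 u) => D D0.
have [i0 i1] : 0 <= (\1_(B w) u : R) /\ 0 <= 1 - (\1_(B w) u : R).
  by rewrite indicE; case: (_ \in _); rewrite ?subrr ?subr0.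
move: (\1_(B w) u) i0 i1 => i i0 i1.
have := mulr_ge0 (mulr_ge0 p0 D0) i0; have := mulr_ge0 (mulr_ge0 p0 D0) i1.
have := mulr_ge0 q0 D0 => h1 h2 h3.
by rewrite ger0_norm; lra.
Qed.

Let Rintegral_step w p q : Rintegral mu `]0, +oo[ (step w p q) = p * logchi_cdf nu w + q.
Proof.
have h1 : mu.-integrable `]0, +oo[ (fun u => p%:E * (EFin \o (fun u => (d u * \1_(B w) u)%R)) u)%E.
  by apply: integrableZl.
have h2 : mu.-integrable `]0, +oo[ (fun u => q%:E * (EFin \o d) u)%E by apply: integrableZl.
rewrite RintegralD// !RintegralZl// Rintegral_d mulr1; congr (_ * _ + _).
have BE : B w = `]0, +oo[ `&` B w.
  by apply/esym/setIidPr => u; rewrite /B /= !in_itv/= => /andP[-> _].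
rewrite -Rintegral_d_le [in RHS]BE Rintegral_mkcondr.
apply: eq_Rintegral => u _; rewrite /= indicE /patch.
by case: ifP => _; rewrite ?mulr1 ?mulr0.
Qed.

Lemma ES_le_step (f : R -> R) w p q : 0 <= p -> 0 <= q ->
  (forall s, 0 < s -> `|f s| <= 1) ->
  (forall s, 0 < s -> s <= expR (c / 2 * w) -> f s <= p + q) ->
  (forall s, expR (c / 2 * w) < s -> f s <= q) ->
  ES nu f <= p * logchi_cdf nu w + q.
Proof.
move=> p0 q0 f1 fp fq; rewrite -Rintegral_step /ES /leb.
apply: (@le_Rintegral_dominated _ _ _ mu _ _ _ (fun u => (1 + p + q) * d u)) => //.
- have h : mu.-integrable `]0, +oo[ (fun u => (1 + p + q)%:E * (EFin \o d) u)%E by apply: integrableZl.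
  exact: h.
- move=> u /=; rewrite in_itv/= andbT => u0; rewrite -/(d u) normrM (ger0_norm (d_ge0 u)) mulrC.
  rewrite ler_wpM2r// (le_trans (f1 _ _)) ?sqrtr_gt0 ?divr_gt0//; lra.
- move=> u /=; rewrite in_itv/= andbT => u0; apply: (le_trans (step_bounds _ _ p0 q0)).
  by rewrite ler_wpM2r ?d_ge0//; lra.
- move=> u /=; rewrite in_itv/= andbT => u0; rewrite -/(d u) /step.
  rewrite [p * _]mulrCA -[q * d u]mulrC -mulrDr ler_wpM2l// indicE.
  have [|uB] := boolP (u \in B w).
    rewrite /B inE/= in_itv/= => /andP[_ h]; rewrite mulr1 fp ?le_sqrt//.
    by rewrite sqrtr_gt0 divr_gt0.
  rewrite mulr0 add0r fq// ltNge le_sqrt//; apply: contra uB => h.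
  by rewrite /B inE/= in_itv/= u0.
Qed.

Lemma ES_ge_step (f : R -> R) w p : 0 <= p ->
  (forall s, 0 < s -> 0 <= f s <= 1) ->
  (forall s, 0 < s -> s <= expR (c / 2 * w) -> p <= f s) ->
  p * logchi_cdf nu w <= ES nu f.
Proof.
move=> p0 f1 fp; rewrite -[leLHS]addr0 -Rintegral_step /ES.
apply: (@le_Rintegral_dominated _ _ _ mu _ _ _ (fun u => (1 + p) * d u)) => //.
- have h : mu.-integrable `]0, +oo[ (fun u => (1 + p)%:E * (EFin \o d) u)%E by apply: integrableZl.
  exact: h.
- move=> u /=; rewrite in_itv/= andbT => u0; apply: (le_trans (step_bounds _ _ p0 (lexx 0))).
  by rewrite ler_wpM2r ?d_ge0//; lra.
- move=> u /=; rewrite in_itv/= andbT => u0; rewrite -/(d u) normrM (ger0_norm (d_ge0 u)) mulrC.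
  have /andP[h0 h1] : 0 <= f (Num.sqrt (u / nu%:R)) <= 1 by rewrite f1// sqrtr_gt0 divr_gt0.
  by rewrite ler_wpM2r// ger0_norm//; lra.
- move=> u /=; rewrite in_itv/= andbT => u0; rewrite -/(d u) /step mul0r addr0.
  rewrite [p * _]mulrCA ler_wpM2l// indicE.
  have s0 : 0 < Num.sqrt (u / nu%:R) by rewrite sqrtr_gt0 divr_gt0.
  have [|uB] := boolP (u \in B w).
    by rewrite /B inE/= in_itv/= => /andP[_ h]; rewrite mulr1 fp ?le_sqrt.
  by rewrite mulr0; have /andP[] := f1 _ s0.
Qed.

End ChiSquare.

(** * Many degrees of freedom *)

Section LogChiLimit.
Context {R : realType}.
Notation mu := (@lebesgue_measure R).
Notation c := (@logchi_scale R).

Lemma cvg_logchi_scale : c @ \oo --> (0 : R).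
Proof.
have -> : c = Num.sqrt \o (fun n : nat => 2 * n%:R^-1) by [].
rewrite -(@sqrtr0 R); apply: continuous_cvg; first exact: sqrt_continuous.
rewrite -(mulr0 (2 : R)); apply: cvgM; first exact: cvg_cst.
apply/gtr0_cvgV0; last exact: cvgr_idn.
by near=> n; rewrite ltr0n; near: n; exists 1%N.
Unshelve. all: end_near. Qed.

(** The third-order remainder in the exponent is at most [n / 2 * (c |x|) ^ 3], which is [c |x| ^ 3]
    because [n / 2 * c ^ 2 = 1]. *)
Lemma cvg_logchi (x : R) : logchi n x @[n --> \oo] --> expR (- (x ^+ 2 / 2)).
Proof.
apply: continuous_cvg; first exact: continuous_expR.
apply: cvgN; apply/cvgrPdist_le => e e0.
have cx : (fun n => c n * `|x| ^+ 3) @ \oo --> (0 : R).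
  by rewrite -(mul0r (`|x| ^+ 3)); apply: cvgM; [exact: cvg_logchi_scale|exact: cvg_cst].
have cx1 : (fun n => c n * `|x|) @ \oo --> (0 : R).
  by rewrite -(mul0r (`|x|)); apply: cvgM; [exact: cvg_logchi_scale|exact: cvg_cst].
near=> n.
have n0 : (0 < n)%N by near: n; exists 1%N.
have nR : 0 < n%:R :> R by rewrite ltr0n.
have c0 : 0 < c n by exact: logchi_scale_gt0.
have v1 : `|c n * x| <= 1.
  rewrite normrM (ger0_norm (ltW c0)); near: n.
  by apply: (cvgr_le _ cx1); exact: ltr01.
have c3 : c n * `|x| ^+ 3 <= e by near: n; exact: (cvgr_le _ cx).
have nuc : n%:R / 2 * c n ^+ 2 = 1.
  by rewrite sqr_logchi_scale//; field; rewrite gt_eqF.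
have := expR_taylor2 v1; set v := c n * x => h.
have -> : x ^+ 2 / 2 - n%:R / 2 * (expR v - 1 - v) =
    - (n%:R / 2 * (expR v - 1 - v - v ^+ 2 / 2)).
  have -> : x ^+ 2 / 2 = (n%:R / 2 * c n ^+ 2) * (x ^+ 2 / 2) by rewrite nuc mul1r.
  have -> : v ^+ 2 = c n ^+ 2 * x ^+ 2 by rewrite exprMn.
  by ring.
rewrite normrN normrM ger0_norm; last by rewrite divr_ge0// ltW.
apply: le_trans c3.
have -> : c n * `|x| ^+ 3 = n%:R / 2 * `|v| ^+ 3.
  rewrite /v normrM (ger0_norm (ltW c0)).
  have -> : n%:R / 2 * (c n * `|x|) ^+ 3 = (n%:R / 2 * c n ^+ 2) * (c n * `|x| ^+ 3) by ring.
  by rewrite nuc mul1r.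
by rewrite ler_pM2l// divr_gt0.
Unshelve. all: end_near. Qed.

(** From here on [logchi_le_exp] applies with [K = 2], so that [logchi] times a function bounded by
    [expR |x|] is still dominated by a multiple of [expR (- |x|)]. *)
Lemma logchi_scale_le n : (8 < n)%N -> 2 * c n < 1.
Proof.
move=> n8; have n0 : (0 < n)%N by exact: leq_trans n8.
have c0 := @logchi_scale_gt0 R n n0.
rewrite -(ltr_pXn2r (n := 2)) ?nnegrE ?mulr_ge0// ?(ltW c0)// expr1n exprMn sqr_logchi_scale//.
have nR : 0 < n%:R :> R by rewrite ltr0n.
rewrite mulrA ltr_pdivrMr// mul1r.
have n8R : 8 < n%:R :> R by rewrite ltr_nat.
lra.
Qed.

Lemma integrable_logchi_exp n (f : R -> R) : (8 < n)%N -> measurable_fun setT f ->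
  (forall x, `|f x| <= expR `|x|) ->
  mu.-integrable [set: R] (EFin \o (fun x => logchi n x * f x)).
Proof.
move=> n8 mf fx.
have ih : mu.-integrable [set: R] (fun x => ((expR (2 ^+ 2))%:E * (EFin \o (fun x => expR (- (1 * `|x|))%R)) x)%E).
  by apply: integrableZl => //; exact: integrable_expRN_norm.
apply: le_integrable ih => //.
  by apply/measurable_EFinP; apply: measurable_funM => //; exact: measurable_logchi.
move=> x _ /=; rewrite lee_fin normrM (ger0_norm (logchi_ge0 _ _)) [leRHS]ger0_norm ?mulr_ge0 ?expR_ge0//.
rewrite mul1r -expRD (_ : 2 ^+ 2 - `|x| = (2 ^+ 2 - 2 * `|x|) + `|x|); last by ring.
rewrite expRD ler_pM ?logchi_ge0//.
by apply: logchi_le_exp; [exact: leq_trans n8|lra|exact: logchi_scale_le].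
Qed.

Lemma logchi_dominated_cvg (f_ : nat -> R -> R) (f : R -> R) :
  (forall n, measurable_fun setT (f_ n)) ->
  (forall n x, (8 < n)%N -> `|f_ n x| <= expR `|x|) ->
  (forall x, f_ n x @[n --> \oo] --> f x) ->
  Rintegral mu setT (fun x => logchi n x * f_ n x) @[n --> \oo] -->
  Rintegral mu setT (fun x => expR (- (x ^+ 2 / 2)) * f x).
Proof.
(* The common dominating function is available only for indices above [8]. *)
move=> mf fx ff; rewrite -(cvg_shiftn 9).
pose h (x : R) := expR (2 ^+ 2) * expR (- (1 * `|x|)).
apply: (@Rintegral_dominated_cvg _ _ _ mu _ _ _ h) => //.
- move=> n; apply: measurable_funM; last exact: mf.
  exact (@measurable_logchi R _ _).
- have h1 := @integrable_expRN_norm R 1 ltr01.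
  exact: (integrableZl measurableT (expR (2 ^+ 2)) h1).
- move=> n x _; rewrite /h normrM (ger0_norm (logchi_ge0 _ _)).
  rewrite mul1r -expRD (_ : 2 ^+ 2 - `|x| = (2 ^+ 2 - 2 * `|x|) + `|x|); last by ring.
  rewrite expRD ler_pM ?logchi_ge0//; last by apply: fx; rewrite ltn_addl.
  by apply: logchi_le_exp; [rewrite ltn_addl|lra|apply: logchi_scale_le; rewrite ltn_addl].
- move=> x _; rewrite (cvg_shiftn 9 (fun n => logchi n x * f_ n x)).
  by apply: cvgM; [exact: cvg_logchi|exact: ff].
Qed.

Let peak := (@normal_peak R 1).
Let peak_gt0 : 0 < peak. Proof. by rewrite normal_peak_gt0// oner_neq0. Qed.

Lemma cvg_logchi_mean (f_ : nat -> R -> R) (f : R -> R) :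
  (forall n, measurable_fun setT (f_ n)) ->
  (forall n x, (8 < n)%N -> `|f_ n x| <= expR `|x|) ->
  (forall x, f_ n x @[n --> \oo] --> f x) ->
  mu.-integrable [set: R] (EFin \o (fun x => phi x * f x)) ->
  Rintegral mu setT (fun x => logchi n x * f_ n x) / logchi_mass n @[n --> \oo] -->
  Rintegral mu setT (fun x => phi x * f x).
Proof.
move=> mf fx ff fi.
have gE (g : R -> R) : mu.-integrable [set: R] (EFin \o (fun x => phi x * g x)) ->
    Rintegral mu setT (fun x => expR (- (x ^+ 2 / 2)) * g x) = peak^-1 * Rintegral mu setT (fun x => phi x * g x).
  move=> gi; rewrite -RintegralZl//; apply: eq_Rintegral => x _.
  by rewrite phiE !mulrA mulVf ?mul1r// gt_eqF.
have ip : mu.-integrable [set: R] (EFin \o (fun x : R => phi x * 1)).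
  by under [X in EFin \o X]eq_fun do rewrite mulr1; exact: integrable_phi.
(* The normalising constant is the case of the constant function [1]; its limit [peak^-1] is
   [sqrt (2 pi)]. *)
have cm : @logchi_mass R n @[n --> \oo] --> peak^-1.
  have := @logchi_dominated_cvg (fun _ _ => 1) (fun=> 1).
  rewrite gE//; have -> : (fun x : R => phi x * 1) = @phi R by apply/funext => x; rewrite mulr1.
  rewrite Rintegral_phi mulr1.
  have -> : (fun n => Rintegral mu setT (fun x => logchi n x * 1)) = @logchi_mass R.
    by apply/funext => n; apply: eq_Rintegral => x _; rewrite mulr1.
  apply => [n|n x _|x]; [exact: measurable_cst| |exact: cvg_cst].
  by rewrite normr1 -expR0 ler_expR.
have -> : Rintegral mu setT (fun x => phi x * f x) =
    Rintegral mu setT (fun x => expR (- (x ^+ 2 / 2)) * f x) / peak^-1.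
  by rewrite gE// mulrAC mulfV ?mul1r// gt_eqF// invr_gt0.
apply: cvgM; first exact: logchi_dominated_cvg.
by apply: cvgV => //; rewrite gt_eqF// invr_gt0.
Qed.

End LogChiLimit.

(** * Tails of the t distribution *)

Section StudentTail.
Context {R : realType}.
Notation mu := (@lebesgue_measure R).

Lemma PhiN_le_inv (b : R) : 0 < b -> Phi (- b) <= b^-1.
Proof.
move=> b0; have [b1|b1] := leP b 1.
  by apply: le_trans (Phi_le1 _) _; rewrite invf_ge1.
have /andP[_ h] := PhiN_ratio ltr01 (ltW b1); apply: (le_trans h).
apply: (@le_trans _ _ (expR (- ((b ^+ 2 - 1 ^+ 2) / 2)))).
  by rewrite ler_piMr ?expR_ge0 ?Phi_le1.
rewrite expRN lef_pV2 ?posrE ?expR_gt0//.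
apply: le_trans (expR_ge1Dx _); have := sqr_ge0 (b - 1); lra.
Qed.

Lemma continuous_max_cst (k : R) (f : R -> R) : continuous f ->
  continuous (fun x => Num.max k (f x)).
Proof.
move=> cf x; apply: (@continuous_max _ _ (fun=> k) f x); [exact: cst_continuous|exact: cf].
Qed.

Variables (nu : nat).
Notation c := (@logchi_scale R nu).
Notation S x := (expR (c / 2 * x)).

Definition t_tail (y : R) : R :=
  Rintegral mu setT (fun x => logchi nu x * Phi (- (y * S x))) / logchi_mass nu.

(** At the threshold [t = t_tail y] and the scale [S w], the conditional distribution function of a
    null p-value exceeds [t / alpha], the line with which the step-up procedure compares it. *)
Definition crit (alpha w : R) : Prop :=
  exists2 y, 0 < y & t_tail y < alpha * Phi (- (y * S w)).

Hypothesis nu0 : (0 < nu)%N.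

Let nuR : 0 < nu%:R :> R. Proof. by rewrite ltr0n. Qed.
Let c0 : 0 < c. Proof. exact: logchi_scale_gt0. Qed.
Let mass0 : 0 < @logchi_mass R nu. Proof. exact: logchi_mass_gt0. Qed.

Let cS : continuous (fun x : R => S x).
Proof.
move=> x; apply: (@continuous_comp _ _ _ (fun x => c / 2 * x) expR); last exact: continuous_expR.
by apply: cvgM; [exact: cvg_cst|exact: cvg_id].
Qed.

Let cPhiS (y : R) : continuous (fun x : R => Phi (- (y * S x))).
Proof.
move=> x; apply: (@continuous_comp _ _ _ (fun x : R => - (y * S x)) (@Phi R)); last exact: continuous_Phi.
by apply: cvgN; apply: cvgM; [exact: cvg_cst|exact: cS].
Qed.

Let iPhiS (y : R) : mu.-integrable [set: R] (EFin \o (fun x => logchi nu x * Phi (- (y * S x)))).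
Proof.
apply: (@integrable_logchiM _ _ nu0 _ _ 1) => //.
by move=> x; rewrite norm_Phi Phi_le1.
Qed.

Let ilc : mu.-integrable [set: R] (EFin \o @logchi R nu).
Proof. exact: integrable_logchi. Qed.

Lemma onem_Ft y : 1 - Ft nu y = t_tail y.
Proof.
rewrite /Ft (@ES_logchi R nu nu0 _ 1).
- apply/eqP; rewrite subr_eq; apply/eqP; rewrite /t_tail -mulrDl -RintegralD//.
    rewrite (_ : Rintegral _ _ _ = logchi_mass nu) ?mulfV ?gt_eqF//.
    by apply: eq_Rintegral => x _; rewrite -mulrDr addrC PhiD_PhiN mulr1.
  have := iPhiS (- y); apply: eq_integrable => // x _.
  by rewrite /= mulNr opprK.
- move=> s; apply: (@continuous_comp _ _ _ (fun s : R => y * s) (@Phi R)); last exact: continuous_Phi.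
  by apply: cvgM; [exact: cvg_cst|exact: cvg_id].
- by move=> s; rewrite Phi_ge0 Phi_le1.
Qed.

Lemma t_tail_lt a b : a < b -> t_tail b < t_tail a.
Proof.
move=> ab; rewrite /t_tail ltr_pM2r ?invr_gt0// -subr_gt0 -RintegralB//.
have h (x : R) : 0 < logchi nu x * Phi (- (a * S x)) - logchi nu x * Phi (- (b * S x)).
  rewrite -mulrBr mulr_gt0 ?logchi_gt0// subr_gt0 Phi_lt// ltrN2 ltr_pM2r ?expR_gt0//.
apply: Rintegral_gt0 => //.
exact: (integrableB measurableT (iPhiS a) (iPhiS b)).
Qed.

Lemma t_tail_le a b : a <= b -> t_tail b <= t_tail a.
Proof. by rewrite le_eqVlt => /predU1P[->//|/t_tail_lt/ltW]. Qed.

Lemma t_tail0 : t_tail 0 = 2^-1.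
Proof.
rewrite /t_tail (_ : Rintegral _ _ _ = logchi_mass nu * 2^-1); first by rewrite mulrAC mulfV ?mul1r// gt_eqF.
rewrite /logchi_mass -RintegralZr//; apply: eq_Rintegral => x _.
by rewrite mul0r oppr0 Phi0.
Qed.

Lemma t_tail_gt0 y : 0 < t_tail y.
Proof.
rewrite divr_gt0//; apply: Rintegral_gt0; first exact: iPhiS.
by move=> x; rewrite mulr_gt0 ?logchi_gt0 ?Phi_gt0.
Qed.

Let iindic (A : set R) : measurable A ->
  mu.-integrable [set: R] (EFin \o (fun x => logchi nu x * \1_A x)).
Proof.
move=> mA; apply: le_integrable ilc => //.
- apply/measurable_EFinP; apply: measurable_funM; first exact: measurable_logchi.
  exact: measurable_indic.
- move=> x _; rewrite /= lee_fin normrM ler_piMr//.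
  by rewrite indicE; case: (_ \in _); rewrite ?normr1 ?normr0.
Qed.

Lemma logchi_cdfE w : logchi_cdf nu w =
  Rintegral mu setT (fun x => logchi nu x * \1_(`]-oo, w]%classic : set R) x) / logchi_mass nu.
Proof.
rewrite /logchi_cdf Rintegral_mkcond; congr (_ / _); apply: eq_Rintegral => x _.
by rewrite /patch indicE; case: ifP => _; rewrite ?mulr1 ?mulr0.
Qed.

(** Markov's inequality: on the event [S <= expR (c / 2 * w)] the decreasing function of [S] is at
    least its value at the end. *)
Lemma t_tail_ge_cdf y w : 0 <= y -> Phi (- (y * S w)) * logchi_cdf nu w <= t_tail y.
Proof.
move=> y0; rewrite logchi_cdfE mulrA ler_pM2r ?invr_gt0//.
rewrite -RintegralZl//; last by apply: iindic; exact: measurable_itv.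
apply: le_Rintegral => //.
- exact: (integrableZl measurableT (Phi (- (y * S w))) (iindic (measurable_itv `]-oo, w]))).
- move=> x _; rewrite mulrCA ler_pM2l ?logchi_gt0// indicE.
have [|_] := boolP (x \in _); last by rewrite mulr0 Phi_ge0.
rewrite inE/= in_itv/= => xw; rewrite mulr1 Phi_le// lerN2 ler_wpM2l// ler_expR ler_pM2l// divr_gt0//.
Qed.

(** The level [3 / 4] leaves a margin over [alpha <= 1 / 2] when combined with [t_tail_ge_cdf]. *)
Lemma exists_logchi_cdf_ge : exists w, 3 / 4 <= @logchi_cdf R nu w.
Proof.
have : Rintegral mu setT (fun x => logchi nu x * \1_(`]-oo, n%:R]%classic : set R) x) @[n --> \oo]
    --> Rintegral mu setT (@logchi R nu).
  apply: (@Rintegral_dominated_cvg _ _ _ mu _ _ _ (@logchi R nu)) => //.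
  - move=> n; apply: measurable_funM; first exact: measurable_logchi.
    by apply: measurable_indic; exact: measurable_itv.
  - move=> n x _; rewrite normrM ger0_norm ?logchi_ge0// ler_piMr ?logchi_ge0//.
    by rewrite indicE; case: (_ \in _); rewrite ?normr1 ?normr0.
  - move=> x _; apply: cvg_near_cst; near=> n.
    rewrite indicE mem_set ?mulr1//= in_itv/=; near: n.
    by apply: nbhs_infty_ger; rewrite num_real.
move=> /cvgr_ge/(_ (3 / 4 * logchi_mass nu)) [|n _ /(_ n (leqnn n)) h].
  by rewrite gtr_pMl//; lra.
by exists n%:R; rewrite logchi_cdfE ler_pdivlMr.
Unshelve. all: end_near. Qed.

Lemma exists_t_tail_lt e : 0 < e -> exists2 y, 0 < y & t_tail y < e.
Proof.
move=> e0.
have : Rintegral mu setT (fun x => logchi nu x * Phi (- (n%:R * S x))) @[n --> \oo]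
    --> Rintegral mu setT (fun=> 0 : R).
  apply: (@Rintegral_dominated_cvg _ _ _ mu _ _ _ (@logchi R nu)) => //.
  - move=> n; apply: measurable_funM; first exact: measurable_logchi.
    by apply: continuous_measurable_fun; exact: cPhiS.
  - move=> n x _; rewrite normrM (ger0_norm (logchi_ge0 _ _)) norm_Phi ler_piMr ?logchi_ge0//.
    exact: Phi_le1.
  - move=> x _; rewrite -(mulr0 (logchi nu x)); apply: cvgM; first exact: cvg_cst.
    have h : (fun n : nat => n%:R^-1 * (S x)^-1) @ \oo --> (0 : R).
      rewrite -(mul0r ((S x)^-1)); apply: cvgM; last exact: cvg_cst.
      apply/gtr0_cvgV0; last exact: cvgr_idn.
      by near=> n; rewrite ltr0n; near: n; exists 1%N.
    apply: squeeze_cvgr (cvg_cst 0) h.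
    near=> n; rewrite Phi_ge0/= -invfM PhiN_le_inv// mulr_gt0 ?expR_gt0// ltr0n.
    by near: n; exists 1%N.
rewrite Rintegral_cst// mul0r => /cvgr_lt/(_ (e * logchi_mass nu)) [|n _ h].
  by rewrite mulr_gt0.
exists n.+1%:R => //; rewrite /t_tail ltr_pdivrMr//.
exact: (h n.+1 (leqnSn n)).
Unshelve. all: end_near. Qed.

Section critical.
Variables (alpha : R) (alpha0 : 0 < alpha) (alpha_le : alpha <= 2^-1).

Lemma crit_le w w' : w <= w' -> crit alpha w' -> crit alpha w.
Proof.
move=> ww' [y y0 h]; exists y; first exact: y0.
apply: (lt_le_trans h) => {h}; apply: ler_wpM2l; first exact: ltW.
apply: Phi_le; rewrite lerN2 ler_pM2l// ler_expR ler_pM2l//; exact: divr_gt0.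
Qed.

(** Beyond a [3 / 4] quantile [M], [t_tail y] is at least [3 / 4 * Phi (- (y * S M))], hence at
    least [alpha * Phi (- (y * S w))] for every [y]. *)
Lemma crit_ubound : exists M, forall w, crit alpha w -> w <= M.
Proof.
have [M hM] := exists_logchi_cdf_ge; exists M => w [y y0 h].
rewrite leNgt; apply/negP => Mw; move: h; apply/negP; rewrite -leNgt.
apply: le_trans (t_tail_ge_cdf M (ltW y0)); rewrite mulrC; apply: ler_pM.
- exact: Phi_ge0.
- exact: ltW.
- by clear hM; apply: Phi_le; rewrite lerN2 ler_pM2l// ler_expR ler_pM2l ?divr_gt0// ltW.
- by move: hM alpha_le; lra.
Qed.

Lemma crit_nonempty : exists w, crit alpha w.
Proof.
have [y y0 h] : exists2 y, 0 < y & t_tail y < alpha / 4 by apply: exists_t_tail_lt; rewrite divr_gt0.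
(* This scale makes [y * S w = 1 / 4], and [Phi (- 1 / 4) >= 1 / 4] by the Lipschitz bound from
   [Phi 0 = 1 / 2]. *)
pose w := ln ((4 * y)^-1) / (c / 2).
have wE : S w = (4 * y)^-1.
  rewrite /w mulrC divfK ?lnK ?posrE ?invr_gt0 ?mulr_gt0// gt_eqF// divr_gt0//.
exists w; exists y => //; apply: (lt_le_trans h); rewrite ler_pM2l// wE.
have -> : y * (4 * y)^-1 = 4^-1 by field; rewrite gt_eqF.
have := @Phi_lipschitz R (- 4^-1) 0; rewrite Phi0.
have -> : (- 4^-1 <= 0 :> R) by lra.
move=> /(_ isT); lra.
Qed.

End critical.

(** * Exponential tilting and two-sided bounds on the t tail *)

Let SE x : S x ^+ 2 = expR (c * x).
Proof. by rewrite expr2 -expRD; congr expR; field. Qed.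

Let S0 x : 0 < S x. Proof. exact: expR_gt0. Qed.

Let S_le x w : x <= w -> S x <= S w.
Proof. by move=> xw; rewrite ler_expR ler_pM2l// divr_gt0. Qed.

(* Tilting the law of [S] by [exp (- y ^ 2 S ^ 2 / 2)] is the rescaling [S = s S'] with [s ^ 2 = nu / (nu + y ^ 2)]. *)
Lemma logchi_tilt (y w : R) (f : R -> R) :
  expR (c * w) * (nu%:R + y ^+ 2) = nu%:R -> continuous f -> (forall x, 0 <= f x) ->
  mu.-integrable [set: R] (EFin \o (fun x => logchi nu x * f (x + w))) ->
  Rintegral mu setT (fun x => logchi nu x * (expR (- (y ^+ 2 * S x ^+ 2 / 2)) * f x)) =
  expR (nu%:R / 2 * (c * w)) * Rintegral mu setT (fun x => logchi nu x * f (x + w)).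
Proof.
move=> yw cf f0 fi; rewrite -RintegralZl// /Rintegral.
rewrite (@ge0_integral_translation R _ w).
- congr fine; apply: eq_integral => x _; congr EFin.
  have key : logchi nu (x + w) * expR (- (y ^+ 2 * S (x + w) ^+ 2 / 2)) =
      expR (nu%:R / 2 * (c * w)) * logchi nu x.
    rewrite SE /logchi -!expRD; congr expR.
    have -> : expR (c * (x + w)) = expR (c * x) * expR (c * w) by rewrite mulrDr expRD.
    have -> : y ^+ 2 * (expR (c * x) * expR (c * w)) / 2 =
        (expR (c * w) * (nu%:R + y ^+ 2) - expR (c * w) * nu%:R) * expR (c * x) / 2 by ring.
    by rewrite yw; field.
  by rewrite [LHS]mulrA key -mulrA.
- move=> x; apply: cvgM; first exact: continuous_logchi.
  apply: cvgM; last exact: cf.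
  apply: (@continuous_comp _ _ _ (fun x => - (y ^+ 2 * S x ^+ 2 / 2)) expR); last exact: continuous_expR.
  apply: cvgN; apply: cvgM; last exact: cvg_cst.
  apply: cvgM; first exact: cvg_cst.
  by apply: cvgM; exact: cS.
- by move=> x; rewrite mulr_ge0 ?logchi_ge0// mulr_ge0 ?expR_ge0.
Qed.

Let E y x w := expR (- ((y ^+ 2 * S x ^+ 2 - y ^+ 2 * S w ^+ 2) / 2)).

Let tail_ratio_le y x w : 0 < y -> x <= w ->
  Phi (- (y * S w)) <= E y w x * Phi (- (y * S x)) /\
  S x / S w * E y w x * Phi (- (y * S x)) <= Phi (- (y * S w)).
Proof.
move=> y0 xw; have h1 : 0 < y * S x by rewrite mulr_gt0.
have h2 : y * S x <= y * S w by rewrite ler_pM2l// S_le.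
have /andP[] := PhiN_ratio h1 h2; rewrite !exprMn.
have -> : y * S x / (y * S w) = S x / S w by rewrite -mulf_div mulfV ?mul1r// gt_eqF.
by [].
Qed.

Let EE y x w : E y x w * E y w x = 1.
Proof. by rewrite -expRD -expR0; congr expR; ring. Qed.

Let cE y w : continuous (fun x => E y x w).
Proof.
move=> x; apply: (@continuous_comp _ _ _ (fun x => - ((y ^+ 2 * S x ^+ 2 - y ^+ 2 * S w ^+ 2) / 2)) expR); last exact: continuous_expR.
apply: cvgN; apply: cvgM; last exact: cvg_cst.
apply: cvgB; last exact: cvg_cst.
apply: cvgM; first exact: cvg_cst.
by apply: cvgM; exact: cS.
Qed.

(** The mean of [1 - s / S] over [S >= s], with [s = S w]: the total loss from the factor [s / S] in
    the lower tail bound. It does not depend on [y]. *)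
Definition scale_deficit (w : R) : R :=
  Rintegral mu setT (fun x => logchi nu x * Num.max 0 (1 - S (w - x))) / logchi_mass nu.

(** The upper tail bound carries the factor [max (1, s / S)]. After the tilt [S] becomes [s S'],
    which leaves [max (1, 1 / S')], free of both [y] and [w]. *)
Definition scale_excess : R :=
  Rintegral mu setT (fun x => logchi nu x * Num.max 1 (S (- x))) / logchi_mass nu.

Lemma continuous_deficit w : continuous (fun x => Num.max 0 (1 - S (w - x))).
Proof.
apply: continuous_max_cst => x; apply: cvgB; first exact: cvg_cst.
apply: (@continuous_comp _ _ _ (fun x => w - x) (fun x : R => S x)); last exact: cS.
by apply: cvgB; [exact: cvg_cst|exact: cvg_id].
Qed.

Lemma deficit_bounds w x : 0 <= Num.max 0 (1 - S (w - x)) <= 1.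
Proof. by rewrite le_max lexx ge_max ler01/= gerBl ltW. Qed.

Lemma continuous_excess : continuous (fun x => Num.max 1 (S (- x))).
Proof.
apply: continuous_max_cst => x; apply: (@continuous_comp _ _ _ (fun x => - x) (fun x : R => S x)); last exact: cS.
by apply: cvgN; exact: cvg_id.
Qed.

(** The bound is uniform in [y], as refuting [crit] demands: the mean of [E y x w] is at least
    [logchi nu w] whatever [y], and the deficit pays for the factor [s / S]. *)
Lemma t_tail_lower y w : 0 < y ->
  Phi (- (y * S w)) * (logchi nu w - scale_deficit w) <= t_tail y.
Proof.
move=> y0.
have nuy : 0 < nu%:R + y ^+ 2 by rewrite addr_gt0// exprn_gt0.
pose v := ln (nu%:R / (nu%:R + y ^+ 2)) / c.
have vE : expR (c * v) * (nu%:R + y ^+ 2) = nu%:R.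
  rewrite /v mulrC [c * _]mulrC divfK ?gt_eqF// lnK ?posrE ?divr_gt0//.
  by rewrite mulrC divfK// gt_eqF.
have iE : mu.-integrable [set: R] (EFin \o (fun x => logchi nu x * E y x w)).
  apply: (@integrable_logchiM _ _ nu0 _ _ (expR (y ^+ 2 * S w ^+ 2 / 2))) => //.
  move=> x; rewrite ger0_norm ?expR_ge0// ler_expR.
  have := mulr_ge0 (sqr_ge0 y) (sqr_ge0 (S x)); lra.
have iD : mu.-integrable [set: R] (EFin \o (fun x => logchi nu x * Num.max 0 (1 - S (w - x)))).
  apply: (@integrable_logchiM _ _ nu0 _ _ 1) => //; first exact: continuous_deficit.
  by move=> x; have /andP[? ?] := deficit_bounds w x; rewrite ger0_norm.
have pw x : Phi (- (y * S w)) * (logchi nu x * E y x w - logchi nu x * Num.max 0 (1 - S (w - x)))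
    <= logchi nu x * Phi (- (y * S x)).
  rewrite -mulrBr mulrCA ler_pM2l ?logchi_gt0//.
  have [xw|/ltW wx] := leP x w.
    have [h _] := tail_ratio_le y0 xw.
    rewrite (@le_trans _ _ (Phi (- (y * S w)) * E y x w))//.
      rewrite ler_pM2l ?Phi_gt0// gerBl le_max lexx//.
    rewrite mulrC -(ler_pM2l (expR_gt0 (- ((y ^+ 2 * S w ^+ 2 - y ^+ 2 * S x ^+ 2) / 2)))) -/(E y w x).
    by rewrite mulrA [E y w x * _]mulrC EE mul1r.
  (* Here [S >= s], so the exponential factor is at most [1], and the multiplicative loss
     [S (w - x)] can be replaced by the additive loss [1 - S (w - x)], which is free of [y]. *)
  have [_ h] := tail_ratio_le y0 wx; apply: le_trans h.
  rewrite mulrC ler_pM2r ?Phi_gt0//.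
  have SwE : S w / S x = S (w - x) by rewrite -expRN -expRD; congr expR; ring.
  have E1 : E y x w <= 1.
    rewrite -expR0 ler_expR oppr_le0 divr_ge0// subr_ge0 ler_pM2l ?exprn_gt0//.
    by rewrite ler_pXn2r ?nnegrE ?expR_ge0// S_le.
  have E0 : 0 <= E y x w by exact: expR_ge0.
  have S1 : S (w - x) <= 1.
    by rewrite -expR0 ler_expR mulr_ge0_le0 ?subr_le0// divr_ge0// ltW.
  rewrite SwE max_r ?subr_ge0//.
  have := mulr_ge0 (_ : 0 <= 1 - S (w - x)) (_ : 0 <= 1 - E y x w).
  rewrite !subr_ge0 => /(_ S1 E1); lra.
(* After tilting, the logarithm of the ratio of the two sides is [nu / 2 * (expR (c (w - v)) - 1 - c
   (w - v))], nonnegative and zero for [v = w]. *)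
have EI : logchi nu w * logchi_mass nu <= Rintegral mu setT (fun x => logchi nu x * E y x w).
  have -> : Rintegral mu setT (fun x => logchi nu x * E y x w) =
      expR (y ^+ 2 * S w ^+ 2 / 2) * (expR (nu%:R / 2 * (c * v)) * logchi_mass nu).
    have i1 : mu.-integrable [set: R] (EFin \o (fun x => logchi nu x * (fun=> 1 : R) (x + v))).
      by apply: eq_integrable ilc => // x _; rewrite /= mulr1.
    have c1 : continuous ((fun=> 1) : R -> R) by move=> ?; exact: cst_continuous.
    have := logchi_tilt vE c1 (fun _ => ler01) i1.
    have -> : Rintegral mu setT (fun x => logchi nu x * (fun=> 1 : R) (x + v)) = logchi_mass nu.
      by apply: eq_Rintegral => x _; rewrite /= mulr1.
    move=> <-; rewrite -RintegralZl//.
      apply: eq_Rintegral => x _.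
      have -> : E y x w = expR (y ^+ 2 * S w ^+ 2 / 2) * expR (- (y ^+ 2 * S x ^+ 2 / 2)).
        by rewrite -expRD; congr expR; ring.
      by ring.
    apply: (@integrable_logchiM _ _ nu0 _ _ 1) => //.
      move=> x; apply: cvgM; last exact: cvg_cst.
      apply: (@continuous_comp _ _ _ (fun x => - (y ^+ 2 * S x ^+ 2 / 2)) expR); last exact: continuous_expR.
      apply: cvgN; apply: cvgM; last exact: cvg_cst.
      apply: cvgM; first exact: cvg_cst.
      by apply: cvgM; exact: cS.
    move=> x; rewrite mulr1 ger0_norm ?expR_ge0// -expR0 ler_expR oppr_le0.
    by rewrite divr_ge0// mulr_ge0 ?sqr_ge0.
  rewrite mulrA ler_pM2r// -expRD ler_expR SE.
  have yE : y ^+ 2 = nu%:R * (expR (- (c * v)) - 1).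
    rewrite expRN; have e0 : expR (c * v) != 0 by rewrite gt_eqF ?expR_gt0.
    have -> : nu%:R = expR (c * v) * (nu%:R + y ^+ 2) by [].
    rewrite mulrBr mulr1 mulrAC mulfV// mul1r.
    by rewrite [X in _ = _ - X]vE; ring.
  rewrite yE.
  have h := expR_ge1Dx (c * w - c * v); rewrite expRD in h.
  have := ler_wpM2l (ltW nuR) h; lra.
rewrite /t_tail ler_pdivlMr// -[_ * _ * logchi_mass nu]mulrA mulrBl /scale_deficit divfK ?gt_eqF//.
apply: (@le_trans _ _ (Phi (- (y * S w)) * Rintegral mu setT (fun x => logchi nu x * E y x w - logchi nu x * Num.max 0 (1 - S (w - x))))).
  by rewrite ler_pM2l ?Phi_gt0// RintegralB// lerD2r.
rewrite -RintegralZl//; last exact: (integrableB measurableT iE iD).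
apply: le_Rintegral => //.
exact: (integrableZl measurableT (Phi (- (y * S w))) (integrableB measurableT iE iD)).
Qed.

Lemma t_tail_upper w : (8 < nu)%N -> w < 0 ->
  exists2 y, 0 < y & t_tail y <= Phi (- (y * S w)) * (logchi nu w * scale_excess).
Proof.
(* The minimiser: for this [y] the shift produced by the tilt is [w] itself, the equality case of
   the lower bound. It is positive because [w < 0]. *)
move=> nu8 w0; pose y := Num.sqrt (nu%:R * (expR (- (c * w)) - 1)).
have ew : 1 < expR (- (c * w)) by rewrite expR_gt1 oppr_gt0 pmulr_rlt0.
have y2 : y ^+ 2 = nu%:R * (expR (- (c * w)) - 1).
  by rewrite sqr_sqrtr// mulr_ge0 ?subr_ge0// ltW.
have y0 : 0 < y by rewrite sqrtr_gt0 mulr_gt0// subr_gt0.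
exists y => //.
have vE : expR (c * w) * (nu%:R + y ^+ 2) = nu%:R.
  by rewrite y2 expRN; field; rewrite gt_eqF// expR_gt0.
have iM : mu.-integrable [set: R] (EFin \o (fun x => logchi nu x * Num.max 1 (S (- x)))).
  apply: integrable_logchi_exp => //.
    by apply: continuous_measurable_fun; exact: continuous_excess.
  move=> x; rewrite ger0_norm ?le_max ?ler01// ge_max -{1}expR0 !ler_expR normr_ge0/=.
  have c1 : c / 2 <= 1 by have := logchi_scale_le nu8 (R := R); lra.
  apply: (@le_trans _ _ (c / 2 * `|x|)).
    by rewrite ler_pM2l ?divr_gt0// -normrN ler_norm.
  by rewrite ler_piMl.
have mE x : Num.max 1 (S (w - (x + w))) = Num.max 1 (S (- x)).
  by congr (Num.max _ (expR (_ * _))); ring.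
have iM' : mu.-integrable [set: R] (EFin \o (fun x => logchi nu x * Num.max 1 (S (w - (x + w))))).
  by under [X in EFin \o X]eq_fun do rewrite mE; exact: iM.
have cM : continuous (fun x => Num.max 1 (S (w - x))).
  apply: continuous_max_cst => x; apply: (@continuous_comp _ _ _ (fun x => w - x) (fun x : R => S x)); last exact: cS.
  by apply: cvgB; [exact: cvg_cst|exact: cvg_id].
have M0 x : 0 <= Num.max 1 (S (w - x)) by rewrite le_max ler01.
have tilt := logchi_tilt vE cM M0 iM'.
have iT : mu.-integrable [set: R] (EFin \o (fun x => logchi nu x * (expR (- (y ^+ 2 * S x ^+ 2 / 2)) * Num.max 1 (S (w - x))))).
  apply: (@integrable_logchi_exp R nu (fun x => expR (- (y ^+ 2 * S x ^+ 2 / 2)) * Num.max 1 (S (w - x)))) => //.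
    apply: continuous_measurable_fun => x; apply: cvgM; last exact: cM.
    apply: (@continuous_comp _ _ _ (fun x => - (y ^+ 2 * S x ^+ 2 / 2)) expR); last exact: continuous_expR.
    apply: cvgN; apply: cvgM; last exact: cvg_cst.
    apply: cvgM; first exact: cvg_cst.
    by apply: cvgM; exact: cS.
  move=> x; rewrite ger0_norm ?mulr_ge0 ?expR_ge0//.
  have h1 : expR (- (y ^+ 2 * S x ^+ 2 / 2)) <= 1.
    by rewrite -expR0 ler_expR oppr_le0 divr_ge0// mulr_ge0 ?sqr_ge0.
  apply: (@le_trans _ _ (Num.max 1 (S (w - x)))); first by rewrite ler_piMl.
  rewrite ge_max -{1}expR0 !ler_expR normr_ge0/=.
  have c1 : c / 2 <= 1 by have := logchi_scale_le nu8 (R := R); lra.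
  apply: (@le_trans _ _ (c / 2 * `|x|)).
    rewrite ler_pM2l ?divr_gt0//; have := ler_norm (- x); rewrite normrN; lra.
  by rewrite ler_piMl.
have pw x : logchi nu x * Phi (- (y * S x)) <=
    (Phi (- (y * S w)) * expR (y ^+ 2 * S w ^+ 2 / 2)) * (logchi nu x * (expR (- (y ^+ 2 * S x ^+ 2 / 2)) * Num.max 1 (S (w - x)))).
  have -> : (Phi (- (y * S w)) * expR (y ^+ 2 * S w ^+ 2 / 2)) * (logchi nu x * (expR (- (y ^+ 2 * S x ^+ 2 / 2)) * Num.max 1 (S (w - x)))) =
      logchi nu x * (E y x w * Num.max 1 (S (w - x)) * Phi (- (y * S w))).
    have -> : E y x w = expR (y ^+ 2 * S w ^+ 2 / 2) * expR (- (y ^+ 2 * S x ^+ 2 / 2)).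
      by rewrite -expRD; congr expR; ring.
    by ring.
  rewrite ler_pM2l ?logchi_gt0//.
  have [xw|/ltW wx] := leP x w.
    have [_ h] := tail_ratio_le y0 xw.
    have SxE : S x / S w = (S (w - x))^-1 by rewrite -!expRN -expRD; congr expR; ring.
    rewrite SxE in h.
    apply: (@le_trans _ _ (E y x w * S (w - x) * Phi (- (y * S w)))); last first.
      by rewrite ler_pM2r ?Phi_gt0// ler_pM2l ?expR_gt0// le_max lexx orbT.
    have k0 : 0 < E y x w * S (w - x) by rewrite mulr_gt0 ?expR_gt0.
    apply: le_trans (_ : _ <= E y x w * S (w - x) * ((S (w - x))^-1 * E y w x * Phi (- (y * S x)))) _.
      rewrite (_ : E y x w * S (w - x) * _ = (E y x w * E y w x) * (S (w - x) / S (w - x)) * Phi (- (y * S x))); last by ring.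
      have SV : S (w - x) / S (w - x) = 1 by rewrite mulfV// gt_eqF.
      rewrite EE SV !mul1r; exact: lexx.
    by rewrite ler_pM2l.
  have [h _] := tail_ratio_le y0 wx; apply: (le_trans h).
  by rewrite ler_pM2r ?Phi_gt0// ler_pMr ?expR_gt0// le_max lexx.
rewrite /t_tail ler_pdivrMr// -[_ * _ * logchi_mass nu]mulrA -[_ * _ * logchi_mass nu]mulrA /scale_excess divfK ?gt_eqF//.
have -> : logchi nu w * Rintegral mu setT (fun x => logchi nu x * Num.max 1 (S (- x))) =
    expR (y ^+ 2 * S w ^+ 2 / 2) * Rintegral mu setT (fun x => logchi nu x * (expR (- (y ^+ 2 * S x ^+ 2 / 2)) * Num.max 1 (S (w - x)))).
  rewrite tilt.
  have -> : Rintegral mu setT (fun x => logchi nu x * Num.max 1 (S (w - (x + w)))) =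
      Rintegral mu setT (fun x => logchi nu x * Num.max 1 (S (- x))).
    by apply: eq_Rintegral => x _; rewrite mE.
  rewrite mulrA; congr (_ * _); rewrite -expRD /logchi; congr expR.
  by rewrite SE y2 expRN; field; rewrite gt_eqF// expR_gt0.
rewrite mulrA -RintegralZl//; apply: le_Rintegral => //.
exact: (integrableZl measurableT (Phi (- (y * S w)) * expR (y ^+ 2 * S w ^+ 2 / 2)) iT).
Qed.

End StudentTail.

(** * The critical scale *)

Section CriticalLimit.
Context {R : realType}.
Notation mu := (@lebesgue_measure R).
Notation c := (@logchi_scale R).

Lemma cvg_logchi_cdf (w : R) : logchi_cdf n w @[n --> \oo] --> Phi w.
Proof.
pose I : R -> R := \1_(`]-oo, w]%classic : set R).
have I1 x : `|I x| <= 1 by rewrite /I indicE; case: (_ \in _); rewrite ?normr1 ?normr0.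
have mI : measurable_fun setT I by apply: measurable_indic; exact: measurable_itv.
have IE (f : R -> R) : Rintegral mu setT (fun x => f x * I x) = Rintegral mu `]-oo, w] f.
  rewrite [RHS]Rintegral_mkcond; apply: eq_Rintegral => x _.
  by rewrite /I /patch indicE; case: ifP => _; rewrite ?mulr1 ?mulr0.
rewrite /Phi /leb -IE.
have -> : (fun n => logchi_cdf n w) = (fun n => Rintegral mu setT (fun x => logchi n x * I x) / logchi_mass n).
  by apply/funext => n; rewrite IE.
apply: (@cvg_logchi_mean R (fun=> I) I) => // [n x _|x|].
- by rewrite (le_trans (I1 x))// -expR0 ler_expR.
- exact: cvg_cst.
- apply: le_integrable (@integrable_phi R) => //.
  + apply/measurable_EFinP; apply: measurable_funM => //.
    by apply: continuous_measurable_fun; exact: continuous_phi.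
  + by move=> x _; rewrite /= lee_fin normrM ler_piMr.
Qed.

Let cvg_S (x : R) : expR (c n / 2 * x) @[n --> \oo] --> (1 : R).
Proof.
have h : (fun n => c n / 2 * x) @ \oo --> (0 : R).
  rewrite (_ : (fun n => c n / 2 * x) = (fun n => c n * (x / 2))); last first.
    by apply/funext => n; rewrite -mulrA [2^-1 * x]mulrC.
  rewrite -(mul0r (x / 2)); apply: cvgM; last exact: cvg_cst.
  exact: cvg_logchi_scale.
have h' : expR t @[t --> (0 : R)] --> (1 : R).
  by rewrite -(@expR0 R); exact: continuous_expR.
exact: (cvg_comp _ _ h h').
Qed.

Let mean_cst (a : R) : Rintegral mu setT (fun x => phi x * a) = a /\
  mu.-integrable [set: R] (EFin \o (fun x => phi x * a)).
Proof.
have ip := @integrable_phi R; split; first by rewrite RintegralZr// Rintegral_phi mul1r.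
under [X in EFin \o X]eq_fun do rewrite mulrC; exact: (integrableZl measurableT a ip).
Qed.

Let id_continuous_max (k l : R) : {for l, continuous (fun t => Num.max k t)}.
Proof. by have := @continuous_max_cst R k id (fun x => cvg_id) l. Qed.

Lemma cvg_scale_excess : @scale_excess R n @[n --> \oo] --> (1 : R).
Proof.
have [e i] := mean_cst 1; rewrite -[X in _ --> X]e; apply: cvg_logchi_mean => //.
- by move=> n; apply: continuous_measurable_fun; exact: continuous_excess.
- move=> n x n8; have n0 : (0 < n)%N by exact: leq_trans n8.
  have c0 := @logchi_scale_gt0 R n n0.
  rewrite ger0_norm ?le_max ?ler01// ge_max -{1}expR0 !ler_expR normr_ge0/=.
  have c1 : c n / 2 <= 1 by have := logchi_scale_le n8 (R := R); lra.
  apply: (@le_trans _ _ (c n / 2 * `|x|)).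
    by rewrite ler_pM2l ?divr_gt0// -normrN ler_norm.
  by rewrite ler_piMl.
- move=> x; rewrite -[X in _ --> X](maxxx (1 : R)).
  exact: (cvg_comp _ _ (cvg_S (- x)) (@id_continuous_max 1 1)).
Qed.

Lemma cvg_scale_deficit (w : R) : scale_deficit n w @[n --> \oo] --> (0 : R).
Proof.
have [e i] := mean_cst 0; rewrite -[X in _ --> X]e; apply: cvg_logchi_mean => //.
- by move=> n; apply: continuous_measurable_fun; exact: continuous_deficit.
- move=> n x _; have /andP[h1 h2] := @deficit_bounds R n w x.
  by rewrite ger0_norm// (le_trans h2)// -expR0 ler_expR.
- move=> x; rewrite -[X in _ --> X](maxxx (0 : R)).
  have h : 1 - expR (c n / 2 * (w - x)) @[n --> \oo] --> (0 : R).
    by rewrite -[X in _ --> X](subrr (1 : R)); apply: cvgB; [exact: cvg_cst|exact: cvg_S].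
  exact: (cvg_comp _ _ h (@id_continuous_max 0 0)).
Qed.

Lemma near_crit (alpha w : R) : w < 0 -> expR (- (w ^+ 2 / 2)) < alpha ->
  \forall n \near \oo, crit n alpha w.
Proof.
move=> w0 wa.
have h : logchi n w * scale_excess n @[n --> \oo] --> expR (- (w ^+ 2 / 2)).
  by rewrite -[X in _ --> X]mulr1; apply: cvgM; [exact: cvg_logchi|exact: cvg_scale_excess].
near=> n.
have n8 : (8 < n)%N by near: n; exists 9%N.
have n0 : (0 < n)%N by exact: leq_trans n8.
have [y y0 hy] := @t_tail_upper R n n0 w n8 w0.
exists y => //; apply: (le_lt_trans hy); rewrite mulrC ltr_pM2r ?Phi_gt0//.
by near: n; exact: (cvgr_lt _ h).
Unshelve. all: end_near. Qed.

Lemma near_not_crit (alpha w : R) : alpha < expR (- (w ^+ 2 / 2)) ->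
  \forall n \near \oo, ~ crit n alpha w.
Proof.
move=> wa.
have h : logchi n w - scale_deficit n w @[n --> \oo] --> expR (- (w ^+ 2 / 2)).
  by rewrite -[X in _ --> X]subr0; apply: cvgB; [exact: cvg_logchi|exact: cvg_scale_deficit].
near=> n.
have n0 : (0 < n)%N by near: n; exists 1%N.
have hn : alpha < logchi n w - scale_deficit n w by near: n; exact: (cvgr_gt _ h).
move=> [y y0]; apply/negP; rewrite -leNgt.
apply: le_trans (t_tail_lower n0 w y0); rewrite mulrC ler_pM2l ?Phi_gt0//.
exact: ltW.
Unshelve. all: end_near. Qed.

Lemma cvg_logchi_cdf_sup_crit (alpha : R) : 0 < alpha -> alpha <= 2^-1 ->
  logchi_cdf n (sup (crit n alpha)) @[n --> \oo] --> Phi (- Num.sqrt (- 2 * ln alpha)).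
Proof.
move=> a0 a2; set z := Num.sqrt _.
have la : ln alpha < 0 by rewrite ln_lt0// a0/=; lra.
have z2 : z ^+ 2 = - 2 * ln alpha by rewrite sqr_sqrtr//; lra.
have z0 : 0 < z by rewrite sqrtr_gt0; lra.
have aE : alpha = expR (- (z ^+ 2 / 2)).
  by rewrite z2 (_ : - (_ / 2) = ln alpha) ?lnK//; field.
apply/cvgrPdist_le => e e0.
(* [d <= e / 2] uses the Lipschitz constant [1] of [Phi]; [d <= z] keeps [- z + d] nonpositive, so
   that its square stays below [z ^ 2]. *)
pose d := Num.min (e / 2) z.
have d0 : 0 < d by rewrite lt_min z0 divr_gt0.
have de : d <= e / 2 by rewrite ge_min lexx.
have dz : d <= z by rewrite ge_min lexx orbT.
have c1 : \forall n \near \oo, crit n alpha (- z - d).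
  apply: near_crit; first by lra.
  rewrite aE ltr_expR; nra.
have c2 : \forall n \near \oo, ~ crit n alpha (- z + d).
  apply: near_not_crit; rewrite {1}aE ltr_expR; nra.
have l1 := @Phi_lipschitz R (- z - d) (- z).
have l2 := @Phi_lipschitz R (- z) (- z + d).
near=> n.
have n0 : (0 < n)%N by near: n; exists 1%N.
have h1 : crit n alpha (- z - d) by near: n.
have h2 : ~ crit n alpha (- z + d) by near: n.
have ub : forall w, crit n alpha w -> w <= - z + d.
  move=> w hw; rewrite leNgt; apply/negP => /ltW h; apply: h2.
  exact: crit_le h hw.
have s1 : - z - d <= sup (crit n alpha).
  by apply: ub_le_sup; [exists (- z + d); exact: ub|exact: h1].
have s2 : sup (crit n alpha) <= - z + d.
  by apply: ge_sup; [exists (- z - d); exact: h1|exact: ub].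
have := logchi_cdf_le n0 s1; have := logchi_cdf_le n0 s2.
have k1 : `|Phi (- z - d) - logchi_cdf n (- z - d)| <= e / 2.
  by near: n; apply: cvgr_dist_le; [exact: cvg_logchi_cdf|rewrite divr_gt0].
have k2 : `|Phi (- z + d) - logchi_cdf n (- z + d)| <= e / 2.
  by near: n; apply: cvgr_dist_le; [exact: cvg_logchi_cdf|rewrite divr_gt0].
move: k1 k2; rewrite !ler_norml => /andP[k1 k1'] /andP[k2 k2'] m1 m2.
have {}l1 : Phi (- z) - Phi (- z - d) <= - z - (- z - d) by apply: l1; lra.
have {}l2 : Phi (- z + d) - Phi (- z) <= - z + d - - z by apply: l2; lra.
apply/andP; split; lra.
Unshelve. all: end_near. Qed.

End CriticalLimit.

(** * Iterated Gaussian expectations *)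

Section GaussianIteration.
Context {R : realType}.
Notation mu := (@lebesgue_measure R).

Lemma integrable_phiM (h : R -> R) (M : R) : measurable_fun setT h ->
  (forall x, `|h x| <= M) -> mu.-integrable [set: R] (EFin \o (fun x => phi x * h x)).
Proof.
move=> mh hM.
have ih : mu.-integrable [set: R] (fun x => (M%:E * (EFin \o @phi R) x)%E).
  by apply: integrableZl => //; exact: integrable_phi.
apply: le_integrable ih => //.
- apply/measurable_EFinP; apply: measurable_funM => //.
  by apply: continuous_measurable_fun; exact: continuous_phi.
- move=> x _ /=; rewrite lee_fin !normrM (ger0_norm (phi_ge0 x)) mulrC ler_wpM2r ?phi_ge0//.
  by rewrite (le_trans (hM x))// ler_norm.
Qed.

(* [gauss_expect k f v]: every integrand met while evaluating [gaussE k f] is integrable, and the value is [v]. *)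
Fixpoint gauss_expect (k : nat) (f : seq R -> R) (v : R) : Prop :=
  match k with
  | 0 => f [::] = v
  | k'.+1 => exists w : R -> R,
      [/\ forall x, gauss_expect k' (fun l => f (x :: l)) (w x),
          mu.-integrable [set: R] (EFin \o (fun x => phi x * w x)) &
          Rintegral mu setT (fun x => phi x * w x) = v]
  end.

Lemma gauss_expect_eq k f g v : (forall l, size l = k -> f l = g l) ->
  gauss_expect k f v -> gauss_expect k g v.
Proof.
elim: k f g v => [|k IH] f g v fg /=; first by rewrite fg.
move=> [w [fw wi wv]]; exists w; split => // x.
by apply: (IH _ _ _ _ (fw x)) => l sl; rewrite fg//= sl.
Qed.

Lemma gauss_expect_cst k (a : R) : gauss_expect k (fun=> a) a.
Proof.
elim: k => //= k IH; exists (fun=> a); split => //.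
- by apply: (@integrable_phiM _ `|a|) => //; exact: measurable_cst.
- have ip : mu.-integrable [set: R] (EFin \o @phi R) by exact: integrable_phi.
  by rewrite RintegralZr// Rintegral_phi mul1r.
Qed.

Lemma gauss_expectD k f g a b : gauss_expect k f a -> gauss_expect k g b ->
  gauss_expect k (fun l => f l + g l) (a + b).
Proof.
elim: k f g a b => [|k IH] f g a b /=; first by move=> -> ->.
move=> [w [fw wi <-]] [w' [gw wi' <-]]; exists (fun x => w x + w' x).
have e : (fun x => phi x * (w x + w' x)) = (fun x => phi x * w x + phi x * w' x).
  by apply/funext => x; rewrite mulrDr.
split; first by move=> x; apply: IH.
- by rewrite e; exact: (integrableD measurableT wi wi').
- by rewrite e RintegralD.
Qed.

Lemma gauss_expectZ k f a (r : R) : gauss_expect k f a ->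
  gauss_expect k (fun l => r * f l) (r * a).
Proof.
elim: k f a => [|k IH] f a /=; first by move=> ->.
move=> [w [fw wi <-]]; exists (fun x => r * w x).
have e : (fun x => phi x * (r * w x)) = (fun x => r * (phi x * w x)).
  by apply/funext => x; rewrite mulrCA.
split; first by move=> x; apply: IH.
- by rewrite e; exact: (integrableZl measurableT r wi).
- by rewrite e RintegralZl.
Qed.

Lemma gauss_expect_bigsum k (I : Type) (s : seq I) (f : I -> seq R -> R) (v : I -> R) :
  (forall i, gauss_expect k (f i) (v i)) ->
  gauss_expect k (fun l => \sum_(i <- s) f i l) (\sum_(i <- s) v i).
Proof.
move=> fv; elim: s => [|i s IH].
  by rewrite big_nil; apply: gauss_expect_eq (gauss_expect_cst k 0) => l _; rewrite big_nil.
rewrite big_cons; apply: gauss_expect_eq (gauss_expectD (fv i) IH) => l _.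
by rewrite big_cons.
Qed.

Lemma gauss_expect_sum k (h : R -> R) (m : R) :
  mu.-integrable [set: R] (EFin \o (fun x => phi x * h x)) ->
  Rintegral mu setT (fun x => phi x * h x) = m ->
  gauss_expect k (fun l => \sum_(x <- l) h x) (k%:R * m).
Proof.
move=> hi hm; elim: k => [|k IH] /=; first by rewrite big_nil mul0r.
have ip : mu.-integrable [set: R] (EFin \o @phi R) by exact: integrable_phi.
have ic : mu.-integrable [set: R] (EFin \o (fun x => k%:R * m * phi x)).
  exact: (integrableZl measurableT (k%:R * m) ip).
exists (fun x => h x + k%:R * m).
have e : (fun x => phi x * (h x + k%:R * m)) = (fun x => phi x * h x + k%:R * m * phi x).
  by apply/funext => x; ring.
split.
- move=> x; apply: gauss_expect_eq (gauss_expectD (gauss_expect_cst k (h x)) IH) => l _.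
  by rewrite big_cons.
- by rewrite e; exact: (integrableD measurableT hi ic).
- by rewrite e RintegralD// RintegralZl// hm Rintegral_phi -natr1; ring.
Qed.

(** [a] accumulates the terms already drawn, for the induction; the cross term [2 a h x] integrates
    to zero because [h] is centred. *)
Lemma gauss_expect_sqr k (h : R -> R) (q a : R) :
  mu.-integrable [set: R] (EFin \o (fun x => phi x * h x)) ->
  Rintegral mu setT (fun x => phi x * h x) = 0 ->
  mu.-integrable [set: R] (EFin \o (fun x => phi x * h x ^+ 2)) ->
  Rintegral mu setT (fun x => phi x * h x ^+ 2) = q ->
  gauss_expect k (fun l => (a + \sum_(x <- l) h x) ^+ 2) (a ^+ 2 + k%:R * q).
Proof.
move=> hi h0 h2i h2; elim: k a => [|k IH] a /=; first by rewrite big_nil mul0r !addr0.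
have ip : mu.-integrable [set: R] (EFin \o @phi R) by exact: integrable_phi.
have ic : mu.-integrable [set: R] (EFin \o (fun x => (a ^+ 2 + k%:R * q) * phi x)).
  exact: (integrableZl measurableT (a ^+ 2 + k%:R * q) ip).
have ih : mu.-integrable [set: R] (EFin \o (fun x => 2 * a * (phi x * h x))).
  exact: (integrableZl measurableT (2 * a) hi).
exists (fun x => (a + h x) ^+ 2 + k%:R * q).
have e : (fun x => phi x * ((a + h x) ^+ 2 + k%:R * q)) =
    (fun x => ((a ^+ 2 + k%:R * q) * phi x + 2 * a * (phi x * h x)) + phi x * h x ^+ 2).
  by apply/funext => x; ring.
have i1 := integrableD measurableT ic ih.
split.
- move=> x; apply: gauss_expect_eq (IH (a + h x)) => l _.
  by rewrite big_cons addrA.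
- by rewrite e; exact: (integrableD measurableT i1 h2i).
- rewrite e RintegralD// RintegralD// !RintegralZl// h0 h2 Rintegral_phi -natr1; ring.
Qed.

Lemma gaussE_itv01 k (f : seq R -> R) : (forall l, size l = k -> 0 <= f l <= 1) ->
  0 <= gaussE k f <= 1.
Proof.
elim: k f => [|k IH] f f01 /=; first exact: f01.
have g01 x : 0 <= gaussE k (fun l => f (x :: l)) <= 1.
  by apply: IH => l sl; apply: f01; rewrite /= sl.
apply/andP; split.
  by apply: Rintegral_ge0 => x _; rewrite mulr_ge0 ?phi_ge0//; have /andP[] := g01 x.
rewrite -[leRHS]Rintegral_phi; apply: (@le_Rintegral_dominated _ _ _ mu _ _ _ (@phi R)) => //.
- exact: integrable_phi.
- move=> x _; have /andP[g0 g1] := g01 x.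
  by rewrite ger0_norm ?mulr_ge0 ?phi_ge0// ler_piMr ?phi_ge0.
- by move=> x _; rewrite ger0_norm ?phi_ge0.
- by move=> x _; have /andP[g0 g1] := g01 x; rewrite ler_piMr ?phi_ge0.
Qed.

Let integrable_dominator (w : R -> R) :
  mu.-integrable [set: R] (EFin \o (fun x => phi x * w x)) ->
  mu.-integrable [set: R] (EFin \o (fun x => phi x + `|phi x * w x|)).
Proof.
move=> wi; have ip : mu.-integrable [set: R] (EFin \o @phi R) by exact: integrable_phi.
exact: (integrableD measurableT ip (integrable_norm wi)).
Qed.

(** Only [g] has a computed expectation. At each level [phi] dominates the part from [f], whose
    values lie between [0] and [1], and [|phi x * w x|] the part from [g]. *)
Lemma gaussE_le k (f g : seq R -> R) v :
  (forall l, size l = k -> 0 <= f l <= 1) -> (forall l, size l = k -> f l <= g l) ->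
  gauss_expect k g v -> gaussE k f <= v.
Proof.
elim: k f g v => [|k IH] f g v f01 fg /=; first by move=> <-; exact: fg.
move=> [w [gw wi <-]].
have f01' x l : size l = k -> 0 <= f (x :: l) <= 1 by move=> sl; apply: f01; rewrite /= sl.
apply: (@le_Rintegral_dominated _ _ _ mu _ _ _ (fun x => phi x + `|phi x * w x|)) => //.
- exact: integrable_dominator.
- move=> x _; have /andP[g0 g1] := gaussE_itv01 (f01' x).
  rewrite ger0_norm ?mulr_ge0 ?phi_ge0// (@le_trans _ _ (phi x)) ?lerDl//.
  by rewrite ler_piMr ?phi_ge0.
- by move=> x _; rewrite lerDr phi_ge0.
- move=> x _; rewrite ler_wpM2l ?phi_ge0//; apply: IH (gw x); first exact: f01'.
  by move=> l sl; apply: fg; rewrite /= sl.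
Qed.

Lemma gaussE_ge k (f g : seq R -> R) v :
  (forall l, size l = k -> 0 <= f l <= 1) -> (forall l, size l = k -> g l <= f l) ->
  gauss_expect k g v -> v <= gaussE k f.
Proof.
elim: k f g v => [|k IH] f g v f01 fg /=; first by move=> <-; exact: fg.
move=> [w [gw wi <-]].
have f01' x l : size l = k -> 0 <= f (x :: l) <= 1 by move=> sl; apply: f01; rewrite /= sl.
apply: (@le_Rintegral_dominated _ _ _ mu _ _ _ (fun x => phi x + `|phi x * w x|)) => //.
- exact: integrable_dominator.
- by move=> x _; rewrite lerDr phi_ge0.
- move=> x _; have /andP[g0 g1] := gaussE_itv01 (f01' x).
  rewrite ger0_norm ?mulr_ge0 ?phi_ge0// (@le_trans _ _ (phi x)) ?lerDl//.
  by rewrite ler_piMr ?phi_ge0.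
- move=> x _; rewrite ler_wpM2l ?phi_ge0//; apply: IH (gw x); first exact: f01'.
  by move=> l sl; apply: fg; rewrite /= sl.
Qed.

(** The indicator of [X >= A], centred for a standard normal [X]. *)
Definition excess (A x : R) : R := (A <= x)%R%:R - Phi (- A).

Let excess_bound A x : `|excess A x| <= 1.
Proof.
rewrite /excess; have := Phi_ge0 (- A); have := Phi_le1 (- A).
by case: (A <= x) => h1 h2; rewrite /= ?sub0r ?normrN ger0_norm; lra.
Qed.

Let measurable_excess A : measurable_fun setT (excess A).
Proof.
apply: measurable_funB; last exact: measurable_cst.
have -> : (fun x => (A <= x)%R%:R) = \1_(`[A, +oo[%classic : set R) :> (R -> R).
  apply/funext => x; rewrite indicE; congr (_%:R); congr nat_of_bool.
  by apply/idP/idP; rewrite inE/= in_itv/= andbT.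
exact: measurable_indic.
Qed.

(** The variance of a sum of [k] independent centred terms bounded by [1]. This is the probabilistic
    input to Chebyshev's inequality below. *)
Lemma gauss_expect_excess k A : exists2 q, q <= k%:R &
  gauss_expect k (fun l => (\sum_(x <- l) excess A x) ^+ 2) q.
Proof.
have i1 := integrable_phiM (measurable_excess A) (excess_bound A).
have b2 x : `|excess A x ^+ 2| <= 1 by rewrite normrX expr_le1.
have i2 := integrable_phiM (measurable_funX 2 (measurable_excess A)) b2.
have ip : mu.-integrable [set: R] (EFin \o @phi R) by exact: integrable_phi.
have h0 : Rintegral mu setT (fun x => phi x * excess A x) = 0.
  have -> : (fun x => phi x * excess A x) = (fun x => ((@phi R) \_ `[A, +oo[%classic) x - Phi (- A) * phi x).
    apply/funext => x; rewrite /excess /patch.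
    have -> : (x \in `[A, +oo[%classic) = (A <= x).
      by apply/idP/idP; rewrite inE/= in_itv/= andbT.
    by case: ifP => _; rewrite ?mulrBr ?mulr1 ?mulr0 1?mulrC.
  rewrite RintegralB//; last first.
  - exact: (integrableZl measurableT (Phi (- A)) ip).
  - have := @integrable_mkcond _ _ _ mu `[A, +oo[%classic (EFin \o @phi R) (measurable_itv _).
    move=> [H _]; have := H (@integrable_phi_on _ _ (measurable_itv _)).
    by rewrite restrict_EFin.
  rewrite -Rintegral_mkcond -PhiN_tail RintegralZl// Rintegral_phi mulr1 subrr//.
exists (0 ^+ 2 + k%:R * Rintegral mu setT (fun x => phi x * excess A x ^+ 2)).
  rewrite expr0n add0r ler_piMr// -Rintegral_phi; apply: le_Rintegral => //.
  move=> x _; rewrite ler_piMr ?phi_ge0//.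
  by apply: le_trans (b2 x); exact: ler_norm.
apply: gauss_expect_eq (gauss_expect_sqr k 0 i1 h0 i2 erefl) => l _.
by rewrite add0r.
Qed.

End GaussianIteration.

(** * The step-up procedure *)

Section StepUp.
Context {R : realType}.
Implicit Types (p s : seq R) (alpha t : R).

(** Turns order statistics into counts, which are sums of indicators. Positions start at [0], hence
    the strict inequality. *)
Lemma sorted_nth_le_count s t j : sorted <=%R s -> (j < size s)%N ->
  (nth 0 s j <= t) = (j < count (fun x => (x <= t)%R) s)%N.
Proof.
elim: s j => // x s IH j /= xs.
have sorted_s := path_sorted xs.
have all_x : all (fun y => x <= y) s by apply: order_path_min xs; exact: le_trans.
have c0 : t < x -> count (fun y => (y <= t)%R) s = 0%N.
  move=> tx; apply/eqP; rewrite -leqn0 leqNgt -has_count -all_predC.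
  apply: sub_all all_x => y xy /=; rewrite -ltNge; exact: lt_le_trans xy.
case: j => [_|j] /=.
  by have [xt|tx] := leP x t => //=; rewrite c0.
rewrite ltnS => js; rewrite (IH j)//.
by have [xt|tx] := leP x t => //=; rewrite c0.
Qed.

Lemma LSU_m_le_size alpha p : (LSU_m alpha p <= size p)%N.
Proof. by apply/bigmax_leqP => k _; rewrite -ltnS. Qed.

Lemma LSU_m_count alpha p : (0 < LSU_m alpha p)%N ->
  (LSU_m alpha p <= count (fun x => (x <= (LSU_m alpha p)%:R * alpha / (size p)%:R)%R) p)%N.
Proof.
move=> m0; pose P (k : 'I_(size p).+1) :=
  (0 < k)%N && (nth 0 (sort <=%R p) k.-1 <= k%:R * alpha / (size p)%:R).
have mE : LSU_m alpha p = (\max_(k | P k) k)%N by [].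
have [k Pk ->] : exists2 k, P k & LSU_m alpha p = k.
  have [/existsP[k0 Pk0]|/existsPn nP] := boolP [exists k, P k].
    have /(eq_bigmax_cond (fun k : 'I_(size p).+1 => k : nat))[k Pk e] : (0 < #|P|)%N.
      by apply/card_gt0P; exists k0.
    by exists k.
  by move: m0; rewrite mE big_pred0// => k; apply/negbTE.
move: Pk => /andP[k_gt0 kle].
have ks : (k.-1 < size (sort <=%R p))%N by rewrite size_sort prednK// -ltnS ltn_ord.
move: kle; rewrite (sorted_nth_le_count _ _ ks) ?sort_sorted//; last exact: le_total.
by have /permP -> := permEl (perm_sort <=%R p); rewrite prednK.
Qed.

Lemma le_LSU_m alpha p j : (0 < j)%N ->
  (j <= count (fun x => (x <= j%:R * alpha / (size p)%:R)%R) p)%N -> (j <= LSU_m alpha p)%N.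
Proof.
move=> j0 jc; have js : (j < (size p).+1)%N by rewrite ltnS (leq_trans jc)// count_size.
rewrite /LSU_m; apply: (leq_trans _ (leq_bigmax_cond (Ordinal js) _)) => //=.
rewrite j0/=; have ks : (j.-1 < size (sort <=%R p))%N by rewrite size_sort prednK.
rewrite (sorted_nth_le_count _ _ ks) ?sort_sorted//; last exact: le_total.
by have /permP -> := permEl (perm_sort <=%R p); rewrite prednK.
Qed.

Lemma FDP_itv01 alpha n0 p : 0 <= FDP alpha n0 p <= 1.
Proof.
have M0 : 0 < (maxn (count (LSU_rej alpha p) p) 1)%:R :> R by rewrite ltr0n leq_max orbT.
rewrite /FDP divr_ge0 ?(ltW M0)//= ler_pdivrMr// mul1r ler_nat.
rewrite leq_max; apply/orP; left.
by rewrite -[X in (_ <= count _ X)%N](cat_take_drop n0) count_cat leq_addr.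
Qed.

Section append.
Variables (alpha : R) (alpha0 : 0 <= alpha) (p : seq R) (n1 : nat).
Let q := p ++ nseq n1 0.

Let rej t : 0 <= t -> count (fun x => (x <= t)%R) q = (count (fun x => (x <= t)%R) p + n1)%N.
Proof. by move=> t0; rewrite count_cat count_nseq t0 mul1n. Qed.

Let t_ge0 (j : nat) : 0 <= j%:R * alpha / (size q)%:R.
Proof. by rewrite divr_ge0// mulr_ge0. Qed.

(** There are at least [m] rejections at the step-up index [m], so [V / R <= V / m]. As [m] is
    random, later estimates have to cover every possible [m]. *)
Lemma FDP_upper : FDP alpha (size p) q <= 0 \/
  exists m, [/\ (0 < m)%N, (m <= size q)%N,
    (m <= count (fun x => (x <= m%:R * alpha / (size q)%:R)%R) p + n1)%N &
    FDP alpha (size p) q <= (count (fun x => (x <= m%:R * alpha / (size q)%:R)%R) p)%:R / m%:R].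
Proof.
have [m0|m_gt0] := posnP (LSU_m alpha q).
  left; rewrite /FDP (_ : count _ (take _ _) = 0%N) ?mul0r//.
  by rewrite (eq_count (a2 := pred0)) ?count_pred0// => x; rewrite /LSU_rej m0.
right; exists (LSU_m alpha q); rewrite m_gt0 LSU_m_le_size -rej//.
have mc := LSU_m_count m_gt0; split => //.
rewrite /FDP take_size_cat//.
have e : LSU_rej alpha q =1 (fun x => x <= (LSU_m alpha q)%:R * alpha / (size q)%:R).
  by move=> x; rewrite /LSU_rej m_gt0.
rewrite !(eq_count e) ler_wpM2l// lef_pV2 ?posrE ?ltr0n ?leq_max ?orbT// ler_nat.
by rewrite leq_max mc.
Qed.

(** At most [n1] rejections are correct, out of at least [j]. *)
Lemma FDP_lower j : (0 < j)%N ->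
  (j <= count (fun x => (x <= j%:R * alpha / (size q)%:R)%R) p)%N ->
  1 - n1%:R / j%:R <= FDP alpha (size p) q.
Proof.
move=> j0 jc.
have jm : (j <= LSU_m alpha q)%N by apply: le_LSU_m => //; rewrite rej// (leq_trans jc)// leq_addr.
have m_gt0 := leq_trans j0 jm.
have := LSU_m_count m_gt0; rewrite rej// => mc.
rewrite /FDP take_size_cat//.
have e : LSU_rej alpha q =1 (fun x => x <= (LSU_m alpha q)%:R * alpha / (size q)%:R).
  by move=> x; rewrite /LSU_rej m_gt0.
rewrite !(eq_count e) rej//.
set V := count _ p in mc *.
have jV : (j <= V + n1)%N by exact: leq_trans mc.
have -> : maxn (V + n1) 1 = (V + n1)%N by apply/maxn_idPl; exact: leq_trans jV.
have V0 : 0 < (V + n1)%:R :> R by rewrite ltr0n (leq_trans j0).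
rewrite ler_pdivlMr// mulrBl mul1r lerBlDr natrD lerD2l mulrAC ler_pdivlMr ?ltr0n//.
by rewrite ler_wpM2l// -natrD ler_nat.
Qed.

End append.
End StepUp.

(** * False discovery rate given the scale *)

Local Opaque Phi t_tail.

Section ConditionalFDR.
Context {R : realType}.
Notation mu := (@lebesgue_measure R).

Lemma sum_excess (A : R) (l : seq R) :
  \sum_(x <- l) excess A x = (count (fun x => (A <= x)%R) l)%:R - (size l)%:R * Phi (- A).
Proof.
elim: l => [|x l IH]; first by rewrite big_nil mul0r subr0.
by rewrite big_cons IH /excess /= natrD -(nat1r (size l)); ring.
Qed.

Variables (nu : nat) (nu0 : (0 < nu)%N) (alpha : R) (alpha0 : 0 < alpha) (alpha_le : alpha <= 2^-1).
Variables (n n0 : nat) (n_gt0 : (0 < n)%N) (n0n : (n0 <= n)%N).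
Notation n1 := (n - n0)%N.
Notation tt := (@t_tail R nu).

Let excess_deviation (x n0' n1' m' n' p d : R) : n' = n0' + n1' -> n' * (p + d) <= m' ->
  m' <= x + n1' -> 0 <= n1' * p -> 2 * n1' <= d * n' -> n' * d / 2 <= x - n0' * p.
Proof. by move=> ->; lra. Qed.

Let sqr_half (x y : R) : (y / 2) ^+ 2 <= x ^+ 2 -> y ^+ 2 <= 4 * x ^+ 2.
Proof. by rewrite expr_div_n; lra. Qed.

Let FDPs s xs := FDP alpha n0 ([seq pval nu s x | x <- xs] ++ nseq n1 0).

Let pvalE s x : pval nu s x = tt (x / s). Proof. exact: onem_Ft. Qed.

Let nR : 0 < n%:R :> R. Proof. by rewrite ltr0n. Qed.

Let nE : n%:R = n0%:R + n1%:R :> R. Proof. by rewrite -natrD subnKC. Qed.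

Let size_p (s : R) (xs : seq R) : size xs = n0 -> size ([seq pval nu s x | x <- xs] ++ nseq n1 0) = n.
Proof. by move=> h; rewrite size_cat size_map size_nseq h subnKC. Qed.

Let FDPs01 s xs : 0 <= FDPs s xs <= 1. Proof. exact: FDP_itv01. Qed.

(** [N], the number of [x >= y * s0], bounds from below the number of p-values up to [t_tail y],
    since [s <= s0]. If [N >= n * t_tail y / alpha], then [FDP_lower] applies with [j = N];
    otherwise [N] is far below its mean. *)
Lemma gaussE_FDP_ge (s s0 y d : R) : 0 < s -> s <= s0 -> 0 < y -> 0 < d ->
  tt y / alpha + 2 * d <= Phi (- (y * s0)) -> n1%:R <= d * n%:R ->
  1 - n1%:R / n%:R * (alpha / tt y) - (n%:R * d ^+ 2)^-1 <=
  gaussE n0 (fun xs : seq R => FDP alpha n0 ([seq pval nu s x | x <- xs] ++ nseq n1 0)).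
Proof.
move=> s_gt0 ss0 y0 d0 gap n1d.
have t0 : 0 < tt y by exact: t_tail_gt0.
set kappa := n1%:R / n%:R * (alpha / tt y).
have kappa0 : 0 <= kappa by apply: mulr_ge0; apply: divr_ge0 => //; exact: ltW.
pose A := y * s0.
have nd0 : 0 < n%:R * d by rewrite mulr_gt0.
(* Chebyshev's inequality in pointwise form: [k] times the squared deviation is at most [- 1] as
   soon as the deviation reaches [n * d], so the lower function is then nonpositive. *)
pose k := - ((n%:R * d) ^+ 2)^-1.
have [q qn gq] := gauss_expect_excess n0 A.
have G := gauss_expectD (gauss_expect_cst n0 (1 - kappa)) (gauss_expectZ k gq).
apply: (@le_trans _ _ (1 - kappa + k * q)).
  rewrite lerD2l /k mulNr lerN2 mulrC ler_pdivrMr ?exprn_gt0//.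
  have -> : (n%:R * d ^+ 2)^-1 * (n%:R * d) ^+ 2 = n%:R by field; rewrite !gt_eqF.
  by apply: (le_trans qn); rewrite ler_nat.
apply: gaussE_ge G; first by move=> l _; exact: FDPs01.
move=> xs sx; rewrite sum_excess sx -/(FDPs s xs).
set N := count _ xs.
have sq0 : 0 <= (N%:R - n0%:R * Phi (- A)) ^+ 2 / (n%:R * d) ^+ 2.
  by rewrite divr_ge0 ?sqr_ge0.
have [good|bad] := leP (n%:R * tt y / alpha) N%:R.
- have N0 : (0 < N)%N.
    rewrite -(ltr0n R); apply: lt_le_trans good; rewrite divr_gt0// mulr_gt0//.
  have tN : tt y <= N%:R * alpha / n%:R.
    by rewrite ler_pdivlMr// -ler_pdivrMr// [tt y * _]mulrC.
  have NP : (N <= count (fun x => (x <= N%:R * alpha / n%:R)%R) [seq pval nu s x | x <- xs])%N.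
    rewrite count_map; apply: sub_count => x /= Ax; rewrite pvalE.
    apply: le_trans tN; apply: t_tail_le => //.
    rewrite ler_pdivlMr//; apply: le_trans Ax; rewrite ler_wpM2l//; exact: ltW.
  have := @FDP_lower R alpha (ltW alpha0) [seq pval nu s x | x <- xs] n1 N N0.
  rewrite size_p// size_map sx => /(_ NP) h.
  apply: le_trans h; rewrite /k mulNr mulrC.
  have : n1%:R / N%:R <= kappa.
    have -> : kappa = n1%:R * (n%:R * tt y / alpha)^-1 by rewrite /kappa; field; rewrite !gt_eqF.
    rewrite ler_wpM2l//.
    by rewrite lef_pV2 ?posrE ?ltr0n// divr_gt0// mulr_gt0.
  lra.
- have /andP[f0 _] := FDPs01 s xs; apply: le_trans f0.
  have Phi1 := Phi_le1 (- A).
  have n1P : n1%:R * Phi (- A) <= n1%:R by rewrite ler_piMr.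
  have nn : n%:R * (tt y / alpha + 2 * d) <= n%:R * Phi (- A) by rewrite ler_pM2l.
  (* Of the gap [2 * d], one [d] pays for the false hypotheses missing from the count and the other
     remains as deviation. *)
  have neg : N%:R - n0%:R * Phi (- A) <= - (n%:R * d).
    have e : n0%:R = n%:R - n1%:R :> R by rewrite nE addrK.
    rewrite e; lra.
  have sq : (n%:R * d) ^+ 2 <= (N%:R - n0%:R * Phi (- A)) ^+ 2.
    rewrite -(sqrrN (N%:R - _)) ler_pXn2r// ?nnegrE; lra.
  have : 1 <= (N%:R - n0%:R * Phi (- A)) ^+ 2 / (n%:R * d) ^+ 2.
    by rewrite ler_pdivlMr ?exprn_gt0// mul1r.
  by rewrite /k mulNr [_^-1 * _]mulrC; lra.
Qed.

(** Split on the random threshold [t]. Below [t_tail (yy J)] the function [H] dominates [alpha / p].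
    Otherwise [t] lies in a cell of the grid, where monotonicity replaces it by the fixed ends of
    the cell; the count there exceeds its mean by a multiple of [n], and summing over the [J] grid
    points covers the choice of the cell. *)
Lemma gaussE_FDP_le (s s1 d h : R) (J : nat) (yy : nat -> R) (H : R -> R) :
  0 < s1 -> s1 <= s -> 0 < d -> (0 < J)%N ->
  yy 0 = 0 -> (forall i j, (i <= j)%N -> yy i <= yy j) ->
  (forall j, (j < J)%N -> Phi (- (s1 * yy j)) + d <= tt (yy j.+1) / alpha) ->
  (forall x, 0 <= H x) -> (forall x, s1 * yy J < x -> alpha <= H x * tt (x / s1)) ->
  mu.-integrable [set: R] (EFin \o (fun x => phi x * H x)) ->
  Rintegral mu setT (fun x => phi x * H x) = h ->
  2 * n1%:R <= d * n%:R ->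
  gaussE n0 (fun xs : seq R => FDP alpha n0 ([seq pval nu s x | x <- xs] ++ nseq n1 0)) <=
  h + 4 * J%:R / (d ^+ 2 * n%:R).
Proof.
move=> s1_gt0 s1s d0 J0 yy0 yyle gap H0 Hx iH hE n1d.
have s_gt0 : 0 < s by exact: lt_le_trans s1s.
have yy_ge0 j : 0 <= yy j by rewrite -yy0 yyle.
have h0 : 0 <= h by rewrite -hE Rintegral_ge0// => x _; rewrite mulr_ge0 ?phi_ge0.
have nd0 : 0 < n%:R * d by rewrite mulr_gt0.
(* Half of the gap [d] is spent on the [n1] false hypotheses; the deviation is then at least
   [n * d / 2], whence the factor [4]. *)
pose k := 4 / (n%:R * d) ^+ 2.
have k0 : 0 <= k by rewrite divr_ge0// sqr_ge0.
have [q qP] : {q : nat -> R & forall j, q j <= n0%:R /\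
    gauss_expect n0 (fun l => (\sum_(x <- l) excess (s1 * yy j) x) ^+ 2) (q j)}.
  apply: (@choice _ _ (fun j qj => qj <= n0%:R /\ gauss_expect n0 (fun l => (\sum_(x <- l) excess (s1 * yy j) x) ^+ 2) qj)).
  by move=> j; have [qj h1 h2] := gauss_expect_excess n0 (s1 * yy j); exists qj.
have G1 := gauss_expectZ n%:R^-1 (gauss_expect_sum n0 iH hE).
have G2 := gauss_expect_bigsum (iota 0 J) (fun j => gauss_expectZ k (proj2 (qP j))).
have G := gauss_expectD G1 G2.
apply: (@le_trans _ _ (n%:R^-1 * (n0%:R * h) + \sum_(j <- iota 0 J) k * q j)); last first.
  apply: lerD.
    by rewrite mulrA ler_piMl// mulrC ler_pdivrMr// mul1r ler_nat.
  apply: (@le_trans _ _ (\sum_(j <- iota 0 J) k * n%:R)).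
    apply: ler_sum => j _; rewrite ler_wpM2l//.
    by apply: (le_trans (proj1 (qP j))); rewrite ler_nat.
  rewrite big_const_seq count_predT size_iota iter_addr_0 -mulr_natr /k.
  rewrite le_eqVlt; apply/orP; left; apply/eqP; field.
  by rewrite !gt_eqF.
apply: gaussE_le G; first by move=> l _; exact: FDPs01.
move=> xs sx; rewrite -/(FDPs s xs).
have sumH0 : 0 <= n%:R^-1 * \sum_(x <- xs) H x.
  by rewrite mulr_ge0 ?invr_ge0 ?(ltW nR)// sumr_ge0.
have sumk0 : 0 <= \sum_(j <- iota 0 J) k * (\sum_(x <- xs) excess (s1 * yy j) x) ^+ 2.
  by apply: sumr_ge0 => j _; rewrite mulr_ge0// sqr_ge0.
have := @FDP_upper R alpha (ltW alpha0) [seq pval nu s x | x <- xs] n1.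
rewrite size_map sx size_p// -/(FDPs s xs) => -[f0|[m [m0 mn mV fV]]].
  by apply: (le_trans f0); exact: addr_ge0.
set t := m%:R * alpha / n%:R in mV fV.
have mR : 0 < m%:R :> R by rewrite ltr0n.
have t0 : 0 < t by rewrite divr_gt0// mulr_gt0.
have mE : m%:R = t * n%:R / alpha by rewrite /t; field; rewrite !gt_eqF.
have [tY|tY] := ltP t (tt (yy J)).
- apply: (le_trans fV); rewrite -[leLHS]addr0; apply: lerD => //.
  (* Each rejected true hypothesis contributes [1 / m = (alpha / t) / n], and [alpha / t <= H x]
     because its p-value is at most [t]. *)
  rewrite mulrC count_map -sum1_count natr_sum mulr_sumr mulr_sumr big_mkcond/=.
  apply: ler_sum => x _; case: ifP => [|_]; last first.
    by rewrite mulr_ge0// invr_ge0 ltW.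
  rewrite mulr1 pvalE => xt.
  have Yx : yy J < x / s.
    rewrite ltNge; apply/negP => /(t_tail_le nu0) h'.
    by have := le_lt_trans (le_trans h' xt) tY; rewrite ltxx.
  have x0 : 0 < x.
    have : 0 < x / s by apply: le_lt_trans Yx.
    by rewrite pmulr_lgt0// invr_gt0.
  have xs1 : x / s <= x / s1 by rewrite ler_pM2l// lef_pV2.
  have s1Y : s1 * yy J < x by rewrite mulrC -ltr_pdivlMr//; exact: lt_le_trans xs1.
  have le_t : tt (x / s1) <= t by apply: le_trans xt; exact: t_tail_le.
  have aH : alpha <= H x * t.
    by apply: (le_trans (Hx _ s1Y)); rewrite ler_wpM2l.
  rewrite mE; have -> : (t * n%:R / alpha)^-1 = n%:R^-1 * (alpha / t) by field; rewrite ?gt_eqF//.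
  by rewrite ler_pM2l ?invr_gt0// ler_pdivrMr.
- have [j jJ /andP[tj1 tj]] : exists2 j, (j < J)%N & tt (yy j.+1) <= t <= tt (yy j).
    have ex : exists j, tt (yy j) <= t by exists J.
    case: (ex_minnP ex) => -[|j] hj jmin.
      (* No threshold lies above the first cell: [t <= alpha <= 1 / 2 = t_tail 0], since
         [m <= n]. *)
      exists 0%N => //; apply/andP; split.
        by apply: le_trans hj; apply: t_tail_le => //; exact: yyle.
      rewrite yy0 t_tail0//; apply: le_trans alpha_le.
      by rewrite /t ler_pdivrMr// mulrC ler_pM2l// ler_nat.
    exists j; first exact: (jmin J tY).
    by rewrite hj/= leNgt; apply/negP => /ltW /jmin; rewrite ltnn.
  have /andP[_ f1] := FDPs01 s xs; apply: (le_trans f1).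
  rewrite -[leLHS]add0r; apply: lerD => //.
  rewrite (bigD1_seq j) ?iota_uniq ?mem_iota//= -[leLHS]addr0; apply: lerD; last first.
    by apply: sumr_ge0 => i _; rewrite mulr_ge0// sqr_ge0.
  rewrite sum_excess sx; set N := count _ xs.
  have VN : (count (fun x => (x <= t)%R) [seq pval nu s x | x <- xs] <= N)%N.
    rewrite count_map; apply: sub_count => x /=; rewrite pvalE => xt.
    have jx : yy j <= x / s.
      rewrite leNgt; apply/negP => /(t_tail_lt nu0) h'.
      by have := lt_le_trans h' (le_trans xt tj); rewrite ltxx.
    apply: (@le_trans _ _ (s * yy j)); first by rewrite ler_wpM2r.
    by rewrite mulrC -ler_pdivlMr.
  have mN : m%:R <= N%:R + n1%:R :> R.
    by rewrite -natrD ler_nat (leq_trans mV)// leq_add2r.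
  have ge1 : n%:R * (Phi (- (s1 * yy j)) + d) <= m%:R.
    rewrite mE mulrAC mulrC ler_pM2r//; apply: (le_trans (gap _ jJ)).
    by rewrite ler_pM2r// invr_gt0.
  have n1P : 0 <= n1%:R * Phi (- (s1 * yy j)) by rewrite mulr_ge0 ?Phi_ge0.
  have pos : n%:R * d / 2 <= N%:R - n0%:R * Phi (- (s1 * yy j)).
    exact: (excess_deviation nE ge1 mN n1P n1d).
  have sq : (n%:R * d / 2) ^+ 2 <= (N%:R - n0%:R * Phi (- (s1 * yy j))) ^+ 2.
    have half0 : 0 <= n%:R * d / 2 by rewrite divr_ge0// ltW.
    have dev0 := le_trans half0 pos.
    by move: half0 dev0 pos; rewrite -!nnegrE => h1 h2 h3; exact: lerXn2r.
  rewrite /k mulrAC ler_pdivlMr ?exprn_gt0// mul1r.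
  exact: sqr_half.
Qed.

End ConditionalFDR.

(** * Many hypotheses *)

Local Opaque logchi_mass logchi_cdf FDR_DEXt.

Section LimitInN.
Context {R : realType}.
Notation mu := (@lebesgue_measure R).

(** Completing the square gives a multiple of the normal density with mean [b / (2 a)] and variance
    [1 / (2 a)]. *)
Lemma integrable_expR_quad (a b : R) : 0 < a ->
  mu.-integrable [set: R] (EFin \o (fun x => expR (- (a * x ^+ 2) + b * x))).
Proof.
move=> a0; pose sg := (Num.sqrt (2 * a))^-1; pose m := b / (2 * a).
have sg0 : 0 < sg by rewrite invr_gt0 sqrtr_gt0 mulr_gt0.
have sg2 : sg ^+ 2 *+ 2 = a^-1.
  rewrite /sg exprVn sqr_sqrtr ?mulr_ge0// ?ltW//.
  by rewrite -mulr_natr invfM; field; rewrite gt_eqF.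
have p0 : 0 < normal_peak sg by rewrite normal_peak_gt0// gt_eqF.
pose k := expR (b ^+ 2 / (4 * a)) / normal_peak sg.
have e : (fun x => expR (- (a * x ^+ 2) + b * x)) = (fun x => k * normal_pdf m sg x).
  apply/funext => x; rewrite normal_pdfE ?gt_eqF// /k /normal_fun sg2.
  rewrite [RHS]mulrA divfK ?gt_eqF// -expRD; congr expR.
  by rewrite invrK /m; field; rewrite gt_eqF.
rewrite e; exact: (integrableZl measurableT k (integrable_normal_pdf m sg)).
Qed.

Variables (nu : nat) (nu0 : (0 < nu)%N).
Notation c := (@logchi_scale R nu).
Notation S x := (expR (c / 2 * x)).
Notation tt := (@t_tail R nu).

Let c2 : 0 < c / 2. Proof. by rewrite divr_gt0// logchi_scale_gt0. Qed.

Let combine_gap (a p q t b g : R) : a * q + g <= t -> a * (p - q) <= b -> b <= g / 2 ->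
  p * a + g / 2 <= t.
Proof. by move=> h1 h2 h3; lra. Qed.

Let close_of_bounds (a b b' x e e' : R) : a - b <= e / 4 -> b' - a <= e / 4 ->
  e' * b <= e' -> e' <= e / 2 -> (1 - e') * b <= x -> x <= b' + e / 2 -> `|a - x| <= e.
Proof. by move=> h1 h2 h3 h4 h5 h6; rewrite ler_norml; apply/andP; split; lra. Qed.

Lemma logchi_cdf_le1 w : @logchi_cdf R nu w <= 1.
Proof.
have := t_tail_ge_cdf nu0 w (lexx 0); rewrite mul0r oppr0 Phi0 t_tail0//.
by rewrite ger_pMr ?invr_gt0.
Qed.

Variables (alpha : R) (alpha0 : 0 < alpha) (alpha_le : alpha <= 2^-1).

(** Noncriticality at [w'] is a weak inequality; raising the scale to [w1] makes it strict,
    uniformly for [y] in a compact set away from [0]. Near [0] that gain vanishes, but there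
    [t_tail y] is close to [1 / 2] while the other side is at most [1 / 4]. *)
Lemma t_tail_gap w' w1 Y : ~ crit nu alpha w' -> w' < w1 ->
  exists2 g, 0 < g & forall y, 0 <= y -> y <= Y -> alpha * Phi (- (S w1 * y)) + g <= tt y.
Proof.
move=> nc w'w1; have [M hM] := @exists_logchi_cdf_ge R nu nu0.
have S' : S w' < S w1 by rewrite ltr_expR ltr_pM2l.
have SM : 0 < S M by exact: expR_gt0.
(* The constants fit because [(1 / 2 - 1 / 12) * (3 / 4) = 1 / 4 + 1 / 16]. *)
pose y0 := (12 * S M)^-1.
have y0_gt0 : 0 < y0 by rewrite invr_gt0 mulr_gt0.
pose g2 := alpha * ((y0 * (S w1 - S w')) * phi (S w1 * Y)).
have g2_gt0 : 0 < g2.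
  by apply: mulr_gt0 => //; apply: mulr_gt0; [apply: mulr_gt0 => //; rewrite subr_gt0|exact: phi_gt0].
exists (Num.min 16^-1 g2) => [|y y_ge0 yY]; first by rewrite lt_min g2_gt0 andbT invr_gt0.
have S1 : 0 < S w1 by exact: expR_gt0.
have g_le1 : Num.min 16^-1 g2 <= 16^-1 by rewrite ge_min lexx.
have g_le2 : Num.min 16^-1 g2 <= g2 by rewrite ge_min lexx orbT.
have [yy0|/ltW y0y] := leP y y0.
- have h := t_tail_ge_cdf nu0 M y_ge0.
  have ySM : y * S M <= 12^-1.
    have -> : 12^-1 = y0 * S M by rewrite /y0; field; rewrite gt_eqF.
    by rewrite ler_pM2r.
  have P1 : 2^-1 - 12^-1 <= Phi (- (y * S M)).
    have l : Phi 0 - Phi (- (y * S M)) <= 0 - - (y * S M).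
      by apply: Phi_lipschitz; rewrite oppr_le0 mulr_ge0// ltW.
    move: l; rewrite Phi0 => l; lra.
  have P2 : Phi (- (S w1 * y)) <= 2^-1.
    by rewrite -Phi0 Phi_le// oppr_le0 mulr_ge0// ltW.
  have h1 : (2^-1 - 12^-1) * (3 / 4) <= Phi (- (y * S M)) * logchi_cdf nu M by apply: ler_pM => //; lra.
  have h2 : alpha * Phi (- (S w1 * y)) <= 2^-1 * 2^-1 by apply: ler_pM => //; [exact: ltW|exact: Phi_ge0].
  lra.
- have y_gt0 : 0 < y by exact: lt_le_trans y0y.
  have h : alpha * Phi (- (y * S w')) <= tt y.
    by rewrite leNgt; apply/negP => h; apply: nc; exists y.
  have yS : y * S w' <= S w1 * y by rewrite mulrC ler_pM2r// ltW.
  have d := PhiN_diff_lower (mulr_ge0 y_ge0 (expR_ge0 _)) yS.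
  have d2 : (y0 * (S w1 - S w')) * phi (S w1 * Y) <= (S w1 * y - y * S w') * phi (S w1 * y).
    apply: ler_pM.
    - by apply: mulr_ge0; [exact: ltW|rewrite subr_ge0 ltW].
    - exact: phi_ge0.
    - have -> : S w1 * y - y * S w' = y * (S w1 - S w') by ring.
      by rewrite ler_pM2r// subr_gt0.
    - by apply: phi_le; [rewrite mulr_ge0// ltW|rewrite ler_pM2l].
  have : g2 <= alpha * (Phi (- (y * S w')) - Phi (- (S w1 * y))).
    by rewrite ler_pM2l//; exact: le_trans d.
  lra.
Qed.

Variable n0 : nat -> nat.
Hypotheses (n0_le : forall n, (n0 n <= n)%N).
Hypothesis n0_cvg : (fun n => (n0 n)%:R / n%:R : R) @ \oo --> (1 : R).

Let cvg_n1 : (fun n => (n - n0 n)%:R / n%:R : R) @ \oo --> (0 : R).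
Proof.
have h : (fun n => 1 - (n0 n)%:R / n%:R : R) @ \oo --> (1 - 1 : R).
  by apply: cvgB; [exact: cvg_cst|exact: n0_cvg].
rewrite -(subrr (1 : R)); apply: cvg_trans h; apply: near_eq_cvg.
near=> n; have n_gt0 : (0 < n)%N by near: n; exists 1%N.
by rewrite natrB// mulrBl divff// pnatr_eq0 -lt0n.
Unshelve. all: end_near. Qed.

Let cvg_inv (k : R) : (fun n : nat => k / n%:R) @ \oo --> (0 : R).
Proof.
rewrite -(mulr0 k); apply: cvgM; first exact: cvg_cst.
apply/gtr0_cvgV0; last exact: cvgr_idn.
by near=> n; rewrite ltr0n; near: n; exists 1%N.
Unshelve. all: end_near. Qed.

Lemma FDR_DEXt_lower w0 e : crit nu alpha w0 -> 0 < e -> e < 1 ->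
  \forall n \near \oo, (1 - e) * logchi_cdf nu w0 <= FDR_DEXt alpha nu n (n0 n).
Proof.
move=> [y y_gt0 hy] e0 e1.
have t0 : 0 < tt y by exact: t_tail_gt0.
pose d := (Phi (- (y * S w0)) - tt y / alpha) / 2.
have d0 : 0 < d.
  by rewrite divr_gt0// subr_gt0 ltr_pdivrMr// mulrC.
have gap : tt y / alpha + 2 * d <= Phi (- (y * S w0)) by rewrite /d; lra.
have k1 : (fun n => (n - n0 n)%:R / n%:R * (alpha / tt y)) @ \oo --> (0 : R).
  by rewrite -(mul0r (alpha / tt y)); apply: cvgM; [exact: cvg_n1|exact: cvg_cst].
near=> n.
have n_gt0 : (0 < n)%N by near: n; exists 1%N.
have nR : 0 < n%:R :> R by rewrite ltr0n.
have r1 : (n - n0 n)%:R <= d * n%:R.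
  by rewrite -ler_pdivrMr//; near: n; exact: (cvgr_le _ cvg_n1).
have r2 : (n - n0 n)%:R / n%:R * (alpha / tt y) <= e / 2.
  by near: n; apply: (cvgr_le _ k1); rewrite divr_gt0.
have r3 : (d ^+ 2)^-1 / n%:R <= e / 2.
  by near: n; apply: (cvgr_le _ (cvg_inv _)); rewrite divr_gt0.
apply: ES_ge_step => //; first lra.
- by move=> s _; apply: gaussE_itv01 => l _; exact: FDP_itv01.
- move=> s s0 sS.
  apply: le_trans (@gaussE_FDP_ge R nu nu0 alpha alpha0 n (n0 n) n_gt0 (n0_le n) s (S w0) y d s0 sS y_gt0 d0 gap r1).
  have : (n%:R * d ^+ 2)^-1 = (d ^+ 2)^-1 / n%:R by rewrite invfM mulrC.
  lra.
Unshelve. all: end_near. Qed.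

Lemma FDR_DEXt_upper w' w1 e : ~ crit nu alpha w' -> w' < w1 -> 0 < e ->
  \forall n \near \oo, FDR_DEXt alpha nu n (n0 n) <= logchi_cdf nu w1 + e.
Proof.
move=> nc w'w1 e0.
have S0 x : 0 < S x by exact: expR_gt0.
pose r := S w' / S w1.
have r0 : 0 < r by rewrite divr_gt0.
have r1 : r < 1 by rewrite ltr_pdivrMr// mul1r ltr_expR ltr_pM2l.
(* For [x > 0] noncriticality at [w'] gives [t_tail (x / S w1) >= alpha * Phi (- (r x)) >= alpha *
   phi (r x + 1)], so [alpha / p] is at most [1 / phi (r x + 1)], integrable against [phi] since
   [r < 1]. The extra [expR x] yields the small factor [expR (- B)] beyond [B]. *)
pose h (x : R) := expR x / phi (r * x + 1).
have h0 x : 0 <= h x by rewrite divr_ge0 ?expR_ge0 ?phi_ge0.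
have ih : mu.-integrable [set: R] (EFin \o (fun x => phi x * h x)).
  have a0 : 0 < (1 - r ^+ 2) / 2.
    by rewrite divr_gt0// subr_gt0 expr_lt1// ltW.
  have i := integrable_expR_quad (1 + r) a0.
  have -> : (fun x => phi x * h x) = (fun x => expR (2^-1) * expR (- ((1 - r ^+ 2) / 2 * x ^+ 2) + (1 + r) * x)).
    apply/funext => x; rewrite /h !phiE.
    have pk : normal_peak 1 != 0 :> R by rewrite gt_eqF// normal_peak_gt0// oner_neq0.
    rewrite -expRD invfM -expRN.
    rewrite (_ : normal_peak 1 * expR (- (x ^+ 2 / 2)) * (expR x * ((normal_peak 1)^-1 * expR (- - ((r * x + 1) ^+ 2 / 2)))) =
      (normal_peak 1 / normal_peak 1) * (expR (- (x ^+ 2 / 2)) * (expR x * expR (- - ((r * x + 1) ^+ 2 / 2))))); last by ring.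
    by rewrite divff// mul1r -!expRD; congr expR; field.
  exact: (integrableZl measurableT (expR (2^-1)) i).
pose K := Rintegral mu setT (fun x => phi x * h x).
have K0 : 0 <= K by apply: Rintegral_ge0 => x _; rewrite mulr_ge0 ?phi_ge0.
(* Large enough that [expR (- B) * K <= e / 2], by [1 + B <= expR B]. *)
pose B := 1 + 2 * K / e.
have B0 : 0 < B by rewrite ltr_pwDl// divr_ge0 ?mulr_ge0// ltW.
pose H (x : R) := expR (- B) * h x.
have H0 x : 0 <= H x by rewrite mulr_ge0 ?expR_ge0.
have HE : (fun x => phi x * H x) = (fun x => expR (- B) * (phi x * h x)).
  by apply/funext => x; rewrite mulrCA.
have iH : mu.-integrable [set: R] (EFin \o (fun x => phi x * H x)).
  by rewrite HE; exact: (integrableZl measurableT (expR (- B)) ih).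
have hK : Rintegral mu setT (fun x => phi x * H x) = expR (- B) * K by rewrite HE RintegralZl.
have hB : expR (- B) * K <= e / 2.
  rewrite expRN mulrC ler_pdivrMr ?expR_gt0//.
  have b := expR_ge1Dx B.
  apply: (@le_trans _ _ (e / 2 * (1 + B))); last by rewrite ler_pM2l// divr_gt0.
  have -> : e / 2 * (1 + B) = e + K by rewrite /B; field; rewrite gt_eqF.
  by rewrite lerDr ltW.
pose Y := B / S w1.
have Y0 : 0 < Y by rewrite divr_gt0.
have [g g0 gap] := t_tail_gap Y nc w'w1.
(* The mesh makes [alpha] times the variation of [Phi] over a cell, at most [alpha * B / J.+1], cost
   half of the gap [g]; the other half is [alpha * d]. *)
have [J JE] : exists J : nat, 2 * alpha * B / g < J.+1%:R.
  exists (Num.bound (2 * alpha * B / g)).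
  apply: (@lt_le_trans _ _ (Num.bound (2 * alpha * B / g))%:R); last by rewrite ler_nat.
  by apply: archi_boundP; rewrite divr_ge0 ?mulr_ge0// ltW.
have JR : 0 < J.+1%:R :> R by rewrite ltr0n.
pose yy (j : nat) := Y * (j%:R / J.+1%:R).
have yy0 : yy 0 = 0 by rewrite /yy mul0r mulr0.
have yyle i j : (i <= j)%N -> yy i <= yy j.
  by move=> ij; rewrite ler_pM2l// ler_pM2r ?invr_gt0// ler_nat.
have yyJ : yy J.+1 = Y by rewrite /yy divff ?mulr1// gt_eqF.
pose d := g / (2 * alpha).
have d0 : 0 < d by rewrite divr_gt0// mulr_gt0.
have ygap j : (j < J.+1)%N -> Phi (- (S w1 * yy j)) + d <= tt (yy j.+1) / alpha.
  move=> jJ; rewrite ler_pdivlMr//.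
  have y1 : 0 <= yy j.+1 by rewrite -yy0 yyle.
  have y2 : yy j.+1 <= Y by rewrite -yyJ yyle.
  have yS : yy j <= yy j.+1 by exact: yyle.
  have G := gap _ y1 y2.
  have L : Phi (- (S w1 * yy j)) - Phi (- (S w1 * yy j.+1)) <= - (S w1 * yy j) - - (S w1 * yy j.+1).
    by apply: Phi_lipschitz; rewrite lerN2 ler_pM2l.
  have st : - (S w1 * yy j) - - (S w1 * yy j.+1) = B / J.+1%:R.
    rewrite /yy /Y -(natr1 j); field.
    by rewrite gt_eqF// gt_eqF.
  have BJ : alpha * (B / J.+1%:R) <= g / 2.
    rewrite mulrA ler_pdivrMr//; move: JE; rewrite ltr_pdivrMr// => JE; lra.
  rewrite st in L.
  have L2 : alpha * (Phi (- (S w1 * yy j)) - Phi (- (S w1 * yy j.+1))) <= alpha * (B / J.+1%:R) by rewrite ler_pM2l.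
  have dE : d * alpha = g / 2 by rewrite /d; field; rewrite gt_eqF.
  rewrite mulrDl dE; exact: (combine_gap G L2 BJ).
have Hx x : S w1 * yy J.+1 < x -> alpha <= H x * tt (x / S w1).
  rewrite yyJ /Y mulrC divfK ?gt_eqF// => Bx.
  have x0 : 0 < x by exact: lt_trans Bx.
  have rx0 : 0 <= r * x by rewrite mulr_ge0// ltW.
  have lb : alpha * phi (r * x + 1) <= tt (x / S w1).
    apply: (@le_trans _ _ (alpha * Phi (- (x / S w1 * S w')))).
      rewrite ler_pM2l// (_ : x / S w1 * S w' = r * x); last by rewrite /r; ring.
      exact: PhiN_lower.
    by rewrite leNgt; apply/negP => hc; apply: nc; exists (x / S w1) => //; rewrite divr_gt0.
  apply: (@le_trans _ _ (H x * (alpha * phi (r * x + 1)))); last by rewrite ler_wpM2l.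
  have -> : H x * (alpha * phi (r * x + 1)) = alpha * expR (x - B).
    by rewrite /H /h expRD; field; rewrite gt_eqF// phi_gt0.
  by rewrite ler_pMr// -[leLHS]expR0 ler_expR subr_ge0 ltW.
near=> n.
have n_gt0 : (0 < n)%N by near: n; exists 1%N.
have nR : 0 < n%:R :> R by rewrite ltr0n.
have q1 : 2 * (n - n0 n)%:R <= d * n%:R.
  suff : (n - n0 n)%:R / n%:R <= d / 2 by rewrite ler_pdivrMr// => q; lra.
  by near: n; apply: (cvgr_le _ cvg_n1); rewrite divr_gt0.
have q2 : 4 * J.+1%:R / d ^+ 2 / n%:R <= e / 2.
  by near: n; apply: (cvgr_le _ (cvg_inv _)); rewrite divr_gt0.
rewrite -[X in X + e]mul1r; apply: ES_le_step => //.
- exact: ltW.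
- move=> s s0.
  have /andP[f0 f1] : 0 <= gaussE (n0 n) (fun xs : seq R => FDP alpha (n0 n) ([seq pval nu s x | x <- xs] ++ nseq (n - n0 n) 0)) <= 1.
    by apply: gaussE_itv01 => l _; exact: FDP_itv01.
  by rewrite ger0_norm.
- move=> s s0 _; apply: (@le_trans _ _ 1); last by rewrite lerDl ltW.
  have /andP[//] : 0 <= gaussE (n0 n) (fun xs : seq R => FDP alpha (n0 n) ([seq pval nu s x | x <- xs] ++ nseq (n - n0 n) 0)) <= 1.
  by apply: gaussE_itv01 => l _; exact: FDP_itv01.
- move=> s /ltW s1.
  apply: (le_trans (@gaussE_FDP_le R nu nu0 alpha alpha0 alpha_le n (n0 n) n_gt0 (n0_le n) s (S w1) d (expR (- B) * K) J.+1 yy H (S0 w1) s1 d0 isT yy0 yyle ygap H0 Hx iH hK q1)).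
  have : 4 * J.+1%:R / (d ^+ 2 * n%:R) = 4 * J.+1%:R / d ^+ 2 / n%:R by rewrite invfM mulrA.
  lra.
Unshelve. all: end_near. Qed.

Lemma cvg_FDR_DEXt : (fun n => FDR_DEXt alpha nu n (n0 n)) @ \oo --> @logchi_cdf R nu (sup (crit nu alpha)).
Proof.
have [M hM] := crit_ubound nu0 alpha0 alpha_le.
have [w00 hw00] := crit_nonempty nu0 alpha0.
have hs : has_sup (crit nu alpha) by split; [exists w00|exists M => w; exact: hM].
set w := sup _; have m0 := @logchi_mass_gt0 R nu nu0.
apply/cvgrPdist_le => e e0.
pose d := Num.min (e * logchi_mass nu / 4) 1.
have d0 : 0 < d by rewrite lt_min ltr01 andbT divr_gt0// mulr_gt0.
have de : d / logchi_mass nu <= e / 4.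
  by rewrite ler_pdivrMr// mulrAC ge_min lexx.
have [w0 cw0 w0w] : exists2 w0, crit nu alpha w0 & w - d < w0.
  by have [w0 h1 h2] := sup_adherent d0 hs; exists w0.
have w0_le : w0 <= w by apply: ub_le_sup => //; case: hs.
(* The upper bound needs a noncritical scale strictly below the one at which it is stated;
   [w + d / 2] and [w + d] are such a pair above the supremum, where criticality itself is
   undecided. *)
have nc : ~ crit nu alpha (w + d / 2).
  move=> hc; have : w + d / 2 <= w by apply: ub_le_sup => //; case: hs.
  lra.
pose e' := Num.min (e / 2) 2^-1.
have e'0 : 0 < e' by rewrite lt_min invr_gt0 divr_gt0//=.
have e'e : e' <= e / 2 by rewrite ge_min lexx.
have e'1 : e' <= 2^-1 by rewrite ge_min lexx orbT.
have e2 : 0 < e / 2 by rewrite divr_gt0.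
have lt1 : w + d / 2 < w + d by lra.
have lt2 : e' < 1 by lra.
have L := FDR_DEXt_lower cw0 e'0 lt2.
have U := FDR_DEXt_upper nc lt1 e2.
have /andP[_ i1] := logchi_cdf_increment nu0 w0_le.
have /andP[_ i2] := @logchi_cdf_increment R nu nu0 w (w + d) ltac:(lra).
have c1 := logchi_cdf_le1 w0; have c0 := @logchi_cdf_ge0 R nu nu0 w0.
have w0d : w - w0 <= d by rewrite lerBlDl -lerBlDr ltW.
have j1 := le_trans i1 (le_trans (ler_wpM2r (ltW (_ : 0 < (logchi_mass nu)^-1)) w0d) de).
have {}j1 : logchi_cdf nu w - logchi_cdf nu w0 <= e / 4 by apply: j1; rewrite invr_gt0.
have wd : w + d - w = d by ring.
have j2 : logchi_cdf nu (w + d) - logchi_cdf nu w <= e / 4 by apply: le_trans i2 _; rewrite wd.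
have e'c : e' * logchi_cdf nu w0 <= e' by apply: ler_piMr; [exact: ltW|exact: c1].
near=> n.
have l : (1 - e') * logchi_cdf nu w0 <= FDR_DEXt alpha nu n (n0 n) by near: n.
have u : FDR_DEXt alpha nu n (n0 n) <= logchi_cdf nu (w + d) + e / 2 by near: n.
exact: (close_of_bounds j1 j2 e'c e'e l u).
Unshelve. all: end_near. Qed.

End LimitInN.

Theorem theorem4p3 (R : realType) (alpha : R) (n0 : nat -> nat) :
  0 < alpha <= 2^-1 ->
  (forall n, (n0 n <= n)%N) ->
  (fun n => (n0 n)%:R / n%:R : R) @ \oo --> (1 : R) ->
  exists FDRinf : nat -> R,
    (forall nu : nat, (0 < nu)%N ->
       (fun n => FDR_DEXt alpha nu n (n0 n)) @ \oo --> FDRinf nu) /\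
    FDRinf @ \oo --> Phi (- Num.sqrt (- 2 * ln alpha)).
Proof.
move=> /andP[alpha0 alpha_le] n0_le n0_cvg.
exists (fun nu => logchi_cdf nu (sup (crit nu alpha))); split.
  by move=> nu nu0; exact: cvg_FDR_DEXt.
exact: cvg_logchi_cdf_sup_crit.
Qed.
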